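(* There is an algorithm that, for any instance of Non-Uniform $k$-Center (NUkC) in a metric space, computes a $3$-approximate solution in time $2^{O(k\log k)}n^2$, where $n=|\mathcal C\cup\mathcal F|$. Moreover, if $\mathcal{C}=\mathcal{F}$, the approximation factor is $2$.
   Context: Non-Uniform $k$-Center (NUkC): given two finite sets of points $\mathcal{C}$ and $\mathcal{F}$ in a metric space $(X,{\sf dist})$, an integer $k > 0$, $t \le k$ distinct integers (radii) $r_1 > r_2 > \ldots > r_t > 0$ and non-negative integers $k_1,\ldots,k_t$ with $\sum_{i=1}^t k_i=k$, the goal is to find a number (dilation) $\alpha$ and, for each $1\le i\le t$, $k_i$ balls centered at points of $\mathcal{F}$ with radius $\alpha\cdot r_i$, such that the union of the chosen balls contains all points of $\mathcal{C}$ and $\alpha$ is minimized. A $\gamma$-approximate solution is a feasible choice of balls whose dilation is at most $\gamma$ times the optimal dilation. *)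

(* Defs.v *)
Set Warnings "-notation-overridden".
From mathcomp Require Import all_boot all_order all_algebra finmap.
From mathcomp Require Import all_classical all_reals all_analysis.

Set Implicit Arguments.
Unset Strict Implicit.
Unset Printing Implicit Defensive.

Import Order.TTheory GRing.Theory Num.Theory.
Import numFieldNormedType.Exports.

Local Open Scope classical_set_scope.
Local Open Scope ring_scope.

Record nukc (R : realType) (X : metricType R) := NUkC {
  clients : {fset X} ;
  facilities : {fset X} ;
  num_balls : nat ;
  num_radii : nat ;
  ball_radius : 'I_num_radii -> nat ;
  ball_mult : 'I_num_radii -> nat ;
  num_balls_gt0 : (0 < num_balls)%N ;
  num_radii_le : (num_radii <= num_balls)%N ;
  radius_decr : forall i j : 'I_num_radii, (i < j)%N -> (ball_radius j < ball_radius i)%N ;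
  radius_gt0 : forall i : 'I_num_radii, (0 < ball_radius i)%N ;
  sum_mult : (\sum_(i < num_radii) ball_mult i = num_balls)%N }.

(** A choice of balls lists, for each radius class, the centers of its balls;
    a center may be repeated. *)
Definition choice_of_balls (R : realType) (X : metricType R) (I : nukc X) :=
  'I_(num_radii I) -> seq X.

(** Balls are closed. The sign condition on [alpha] only matters when there are
    no clients: otherwise it follows from coverage. *)
Definition feasible (R : realType) (X : metricType R) (I : nukc X)
    (alpha : R) (S : choice_of_balls I) : Prop :=
  [/\ 0 <= alpha,
      forall i, size (S i) = ball_mult i,
      forall i x, x \in S i -> x \in facilities I &
      forall c, c \in clients I ->
        exists i, exists2 x, x \in S i & mdist x c <= alpha * (ball_radius i)%:R].

Definition opt_dilation (R : realType) (X : metricType R) (I : nukc X) : R :=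
  inf [set alpha : R | exists S : choice_of_balls I, feasible alpha S].

Definition approx_solution (R : realType) (X : metricType R) (I : nukc X)
    (gamma alpha : R) (S : choice_of_balls I) : Prop :=
  feasible alpha S /\ alpha <= gamma * opt_dilation I.

(** Algorithms are programs of a unit-cost real RAM. The memory consists of
    countably many index variables and index arrays,
    holding natural numbers, and countably many real variables and real arrays.
    Arrays are unbounded and indexed by the value of an index variable.
    Each instruction and each evaluation of a test costs one time unit. There is
    no unit-cost multiplication of indices and no conversion from reals to
    indices (no floor), so that the unit cost of arithmetic on numbers of
    unbounded size cannot be abused. The syntax of programs does not mention
    the field of reals: the only real constants are natural numbers. *)

Inductive instr :=
  | IConst of nat & nat
  | IAdd of nat & nat & nat
  | ISub of nat & nat & nat
  | ILoad of nat & nat & nat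
  | IStore of nat & nat & nat
  | RConst of nat & nat
  | RAdd of nat & nat & nat
  | RSub of nat & nat & nat
  | RMul of nat & nat & nat
  | RDiv of nat & nat & nat
  | RLoad of nat & nat & nat
  | RStore of nat & nat & nat.

Inductive test :=
  | ILt of nat & nat
  | RLe of nat & nat.

Inductive program :=
  | Do of instr
  | Seq of program & program
  | If of test & program & program
  | While of test & program.

Record state (R : realType) := State {
  ivar : nat -> nat ;
  iarr : nat -> nat -> nat ;
  rvar : nat -> R ;
  rarr : nat -> nat -> R }.

Definition upd (T : Type) (f : nat -> T) (x : nat) (v : T) : nat -> T :=
  fun y => if y == x then v else f y.

Definition set_ivar (R : realType) (s : state R) (x m : nat) : state R :=
  State (upd (ivar s) x m) (iarr s) (rvar s) (rarr s).

Definition set_iarr (R : realType) (s : state R) (a j m : nat) : state R :=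
  State (ivar s) (upd (iarr s) a (upd (iarr s a) j m))
        (rvar s) (rarr s).

Definition set_rvar (R : realType) (s : state R) (u : nat) (e : R) : state R :=
  State (ivar s) (iarr s) (upd (rvar s) u e) (rarr s).

Definition set_rarr (R : realType) (s : state R) (b j : nat) (e : R) : state R :=
  State (ivar s) (iarr s) (rvar s)
        (upd (rarr s) b (upd (rarr s b) j e)).

Definition run_instr (R : realType) (i : instr) (s : state R) : state R :=
  match i with
  | IConst x m => set_ivar s x m
  | IAdd x y z => set_ivar s x (ivar s y + ivar s z)%N
  | ISub x y z => set_ivar s x (ivar s y - ivar s z)%N
  | ILoad x a y => set_ivar s x (iarr s a (ivar s y))
  | IStore a x y => set_iarr s a (ivar s x) (ivar s y)
  | RConst u m => set_rvar s u m%:R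
  | RAdd u v w => set_rvar s u (rvar s v + rvar s w)
  | RSub u v w => set_rvar s u (rvar s v - rvar s w)
  | RMul u v w => set_rvar s u (rvar s v * rvar s w)
  | RDiv u v w => set_rvar s u (rvar s v / rvar s w)
  | RLoad u b x => set_rvar s u (rarr s b (ivar s x))
  | RStore b x u => set_rarr s b (ivar s x) (rvar s u)
  end.

Definition run_test (R : realType) (b : test) (s : state R) : bool :=
  match b with
  | ILt x y => (ivar s x < ivar s y)%N
  | RLe u v => rvar s u <= rvar s v
  end.

(** [exec P s T s']: started in [s], [P] halts in [s'] after exactly [T] steps. *)
Inductive exec (R : realType) : program -> state R -> nat -> state R -> Prop :=
  | ExecDo i s : exec (Do i) s 1 (run_instr i s)
  | ExecSeq P1 P2 s s1 s2 T1 T2 :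
      exec P1 s T1 s1 -> exec P2 s1 T2 s2 -> exec (Seq P1 P2) s (T1 + T2) s2
  | ExecIf b P1 P2 s s1 T1 :
      exec (if run_test b s then P1 else P2) s T1 s1 ->
      exec (If b P1 P2) s T1.+1 s1
  | ExecWhileF b P s : run_test b s = false -> exec (While b P) s 1 s
  | ExecWhileT b P s s1 s2 T1 T2 : run_test b s = true ->
      exec P s T1 s1 -> exec (While b P) s1 T2 s2 ->
      exec (While b P) s (T1 + T2).+1 s2.

Lemma exec_det (R : realType) (P : program) (s s1 s2 : state R) (T1 T2 : nat) :
  exec P s T1 s1 -> exec P s T2 s2 -> T1 = T2 /\ s1 = s2.
Proof.
move=> e1; elim: e1 T2 s2 => {P s T1 s1}.
- by move=> i s T2 s2 e2; inversion e2.
- move=> P1 P2 s s1 s2 T1 T2 _ IH1 _ IH2 T s' e; inversion e; subst.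
  match goal with h : exec P1 _ _ _ |- _ => case: (IH1 _ _ h) => ? ?; subst end.
  by match goal with h : exec P2 _ _ _ |- _ => case: (IH2 _ _ h) => ? ?; subst end.
- move=> b P1 P2 s s1 T1 _ IH T s' e; inversion e; subst.
  by match goal with h : exec _ s _ _ |- _ => case: (IH _ _ h) => -> -> end.
- by move=> b P s bF T s' e; inversion e; subst => //; congruence.
- move=> b P s s1 s2 T1 T2 bT _ IH1 _ IH2 T s' e; inversion e; subst.
    by congruence.
  match goal with h : exec P _ _ _ |- _ => case: (IH1 _ _ h) => ? ?; subst end.
  by match goal with h : exec (While b P) _ _ _ |- _ =>
    case: (IH2 _ _ h) => ? ?; subst end.
Qed.

(** The points are referred to by their positions in a duplicate-free list [pts]
    of the points of [clients I `|` facilities I]; with [n := size pts]: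
    - index variables 0, 1, 2 hold n, the number of radii, the number of balls;
    - index array 0 holds the multiplicities of the radii;
    - index arrays 1 and 2 hold the indicators of clients and facilities;
    - real array 0 holds the n x n distance matrix, row by row;
    - real array 1 holds the radii, in decreasing order.
    All other cells are 0. *)

Definition mem_entry (R : realType) (X : metricType R) (A : {fset X})
    (pts : seq X) (p : nat) : nat :=
  if onth pts p is Some x then nat_of_bool (x \in A) else 0%N.

Definition dist_entry (R : realType) (X : metricType R) (pts : seq X) (m : nat) : R :=
  match onth pts (m %/ size pts), onth pts (m %% size pts) with
  | Some x, Some y => mdist x y
  | _, _ => 0
  end.

Definition input (R : realType) (X : metricType R) (I : nukc X) (pts : seq X) :
    state R :=
  State
    (fun x => nth 0%N [:: size pts; num_radii I; num_balls I] x)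
    (fun a j => match a with
       | 0%N => if insub j is Some i then ball_mult (n := I) i else 0%N
       | 1%N => mem_entry (clients I) pts j
       | 2%N => mem_entry (facilities I) pts j
       | _ => 0%N
       end)
    (fun _ => 0)
    (fun b j => match b with
       | 0%N => dist_entry pts j
       | 1%N => if insub j is Some i then (ball_radius (n := I) i)%:R else 0
       | _ => 0
       end).

(** The dilation is returned in real variable 0. Index array 3 returns the
    positions in [pts] of the centers: first those of the balls of the largest
    radius class, then those of the next class, and so on. Entries that are not
    positions of points are dropped by [pmap], which makes the output infeasible. *)

Definition output_dilation (R : realType) (s : state R) : R := rvar s 0%N.

Definition output_balls (R : realType) (X : metricType R) (I : nukc X)
    (pts : seq X) (s : state R) : choice_of_balls I :=
  fun i => pmap (fun l => onth pts (iarr s 3%N l))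
                (iota (\sum_(j < num_radii I | (j < i)%N) ball_mult j) (ball_mult i)).

Arguments output_balls {R X} I pts s.

(* Main.v *)
Require Import Defs.
From mathcomp Require Import all_boot all_order all_algebra finmap.
From mathcomp Require Import all_classical all_reals all_analysis.
From mathcomp Require Import zify ring.

Set Implicit Arguments.
Unset Strict Implicit.
Unset Printing Implicit Defensive.

Import Order.TTheory GRing.Theory Num.Theory.
Import numFieldNormedType.Exports.

Local Open Scope classical_set_scope.
Local Open Scope ring_scope.

(** Fix the k balls with their radii and proceed as in Gonzalez' algorithm: take
    the client c farthest from the clients chosen so far, relative to the radii
    of their balls, guess the ball l that covers c in an optimal solution of
    dilation alpha, and center l at the facility nearest to c. If c is at relative
    distance at most 2 alpha, then so are all clients; otherwise c is not in an
    optimal ball guessed before, so that l is new. As c and the optimal center of l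
    are at distance at most alpha r_l, the center chosen for l is within
    delta alpha r_l of c, where delta = 1, or delta = 0 if clients are facilities.
    Hence dilation (2 + delta) alpha suffices. The order of the clients does not
    depend on alpha: it is enough to try all k ^ k sequences of guesses, to compute
    the actual dilation of each outcome, and to keep the best one. *)

(** * A program logic with time bounds for the RAM *)

Section TimedLogic.

Local Open Scope nat_scope.

Variable R : realType.
Implicit Types (s : state R) (P : program) (Q : state R -> Prop) (B : nat).

(** Total correctness with a time bound. Since execution is deterministic, one halting run describes
    the behaviour from [s] completely. *)
Definition runs P s B Q :=
  exists T s', [/\ exec P s T s', (T <= B)%N & Q s'].

Lemma runs_weaken P s B B' Q Q' :
  runs P s B Q -> (B <= B')%N -> (forall s', Q s' -> Q' s') -> runs P s B' Q'.
Proof.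
move=> [T [s' [e TB Qs]]] BB' QQ'; exists T, s'; split => //.
- exact: leq_trans BB'.
- exact: QQ'.
Qed.

Lemma runs_leq P s B B' Q : (B <= B')%N -> runs P s B Q -> runs P s B' Q.
Proof. by move=> lB r; exact: runs_weaken r lB _. Qed.

Lemma runs_seq P1 P2 s B1 B2 Q :
  runs P1 s B1 (fun s1 => runs P2 s1 B2 Q) -> runs (Seq P1 P2) s (B1 + B2) Q.
Proof.
move=> [T1 [s1 [e1 l1 [T2 [s2 [e2 l2 q]]]]]]; exists (T1 + T2)%N, s2.
by split=> //; [exact: ExecSeq e1 e2|exact: leq_add].
Qed.

Lemma runs_if b P1 P2 s B Q :
  runs (if run_test b s then P1 else P2) s B Q -> runs (If b P1 P2) s B.+1 Q.
Proof.
by move=> [T [s' [e l q]]]; exists T.+1, s'; split=> //; exact: ExecIf.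
Qed.

(** There is no skip instruction; index variable 24 is written but never read. *)
Fixpoint block (l : seq instr) : program :=
  if l is i :: l' then Seq (Do i) (block l') else Do (IConst 24 0).

Definition run_block (l : seq instr) s : state R :=
  set_ivar (foldl (fun s i => run_instr i s) s l) 24 0.

Lemma runs_block l s Q : Q (run_block l s) -> runs (block l) s (size l).+1 Q.
Proof.
elim: l s => [|i l IH] s q /=.
  by exists 1%N, (set_ivar s 24 0); split=> //; exact: ExecDo.
rewrite -add1n; apply: runs_seq.
by exists 1%N, (run_instr i s); split => //; [exact: ExecDo|exact: IH].
Qed.

(** Index variable 3 permanently holds 1. *)
Definition For (x y : nat) P : program :=
  Seq (Do (IConst x 0)) (While (ILt x y) (Seq P (Do (IAdd x x 3)))).

(** A syntactic over-approximation of what a program may modify: index variables, index arrays, real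
    variables and real arrays, an array counting as a whole. *)
Fixpoint writes P : seq nat * seq nat * seq nat * seq nat :=
  match P with
  | Do i => match i with
    | IConst x _ | IAdd x _ _ | ISub x _ _ | ILoad x _ _ => ([:: x], [::], [::], [::])
    | IStore a _ _ => ([::], [:: a], [::], [::])
    | RConst u _ | RAdd u _ _ | RSub u _ _ | RMul u _ _ | RDiv u _ _ | RLoad u _ _ =>
        ([::], [::], [:: u], [::])
    | RStore b _ _ => ([::], [::], [::], [:: b])
    end
  | Seq P1 P2 | If _ P1 P2 =>
      let: (a1, b1, c1, d1) := writes P1 in
      let: (a2, b2, c2, d2) := writes P2 in
      (a1 ++ a2, b1 ++ b2, c1 ++ c2, d1 ++ d2)
  | While _ P1 => writes P1
  end.

(** The frame condition. It complements the postconditions of [runs], which then mention only the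
    cells that a program is meant to change. *)
Definition agree P s s' :=
  let: (a, b, c, d) := writes P in
  [/\ {in [predC a], ivar s' =1 ivar s}, {in [predC b], iarr s' =1 iarr s},
      {in [predC c], rvar s' =1 rvar s} & {in [predC d], rarr s' =1 rarr s}].

Lemma agree_refl P s : agree P s s.
Proof. by rewrite /agree; case: (writes P) => [[[a b] c] d]. Qed.

Lemma agree_trans P s1 s2 s3 : agree P s1 s2 -> agree P s2 s3 -> agree P s1 s3.
Proof.
rewrite /agree; case: (writes P) => [[[a b] c] d] [? ? ? ?] [h1 h2 h3 h4].
by split=> x xin; rewrite ?h1 ?h2 ?h3 ?h4//; auto.
Qed.

Lemma agree_seql P1 P2 s1 s2 : agree P1 s1 s2 -> agree (Seq P1 P2) s1 s2.
Proof.
rewrite /agree/=.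
case: (writes P1) => [[[a1 b1] c1] d1]; case: (writes P2) => [[[a2 b2] c2] d2].
by move=> [h1 h2 h3 h4]; split=> x; rewrite inE mem_cat negb_or => /andP[? ?]; auto.
Qed.

Lemma agree_seqr P1 P2 s1 s2 : agree P2 s1 s2 -> agree (Seq P1 P2) s1 s2.
Proof.
rewrite /agree/=.
case: (writes P1) => [[[a1 b1] c1] d1]; case: (writes P2) => [[[a2 b2] c2] d2].
by move=> [h1 h2 h3 h4]; split=> x; rewrite inE mem_cat negb_or => /andP[? ?]; auto.
Qed.

Lemma upd_neq (T : Type) (f : nat -> T) x v y : y != x -> upd f x v y = f y.
Proof. by rewrite /upd => /negPf->. Qed.

Lemma exec_agree P s T s' : exec P s T s' -> agree P s s'.
Proof.
elim=> {P s T s'}.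
- by case=> [x m|x y z|x y z|x a y|a x y|u m|u v w|u v w|u v w|u v w|u b x|b x u] s;
    split=> // z' /=; rewrite !inE => zx; rewrite upd_neq.
- move=> P1 P2 s s1 s2 T1 T2 _ a1 _ a2.
  exact: agree_trans (agree_seql _ a1) (agree_seqr _ a2).
- move=> b P1 P2 s s1 T1 _ a1.
  (* [writes] treats a conditional like the sequence of its branches. *)
  change (agree (Seq P1 P2) s s1).
  by case: (run_test b s) a1 => ?; [exact: agree_seql|exact: agree_seqr].
- by move=> b P s _; exact: agree_refl.
- move=> b P s s1 s2 T1 T2 _ _ a1 _ a2.
  exact: (agree_trans (s2 := s1)) a1 a2.
Qed.

Lemma runs_agree P s B Q :
  runs P s B Q -> runs P s B (fun s' => agree P s s' /\ Q s').
Proof.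
move=> [T [s' [e l q]]]; exists T, s'; split=> //; split=> //.
exact: exec_agree e.
Qed.

Definition iwrites P := (writes P).1.1.1.

Lemma agree_ivar P s s' x : agree P s s' -> x \notin iwrites P -> ivar s' x = ivar s x.
Proof.
by rewrite /agree /iwrites; case: (writes P) => [[[a b] c] d] [h _ _ _] /=; exact: h.
Qed.

Definition awrites P := (writes P).1.1.2.

Lemma agree_iarr P s s' x : agree P s s' -> x \notin awrites P -> iarr s' x = iarr s x.
Proof.
by rewrite /agree /awrites; case: (writes P) => [[[a b] c] d] [_ h _ _] /=; exact: h.
Qed.

Definition rwrites P := (writes P).1.2.

Lemma agree_rvar P s s' x : agree P s s' -> x \notin rwrites P -> rvar s' x = rvar s x.
Proof.
by rewrite /agree /rwrites; case: (writes P) => [[[a b] c] d] [_ _ h _] /=; exact: h.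
Qed.

Definition rawrites P := (writes P).2.

Lemma agree_rarr P s s' x : agree P s s' -> x \notin rawrites P -> rarr s' x = rarr s x.
Proof.
by rewrite /agree /rawrites; case: (writes P) => [[[a b] c] d] [_ _ _ h] /=; exact: h.
Qed.

(** The invariant rule. A round costs the body, the test and the increment; the final [+ 2] pays for
    setting the counter to 0 and for the failing test. Each round is handed the agreement with the
    initial state, so invariants list only what changes. *)
Lemma runs_for x y P s n B (I : nat -> state R -> Prop) Q :
  x \notin y :: 3 :: iwrites P -> y \notin iwrites P -> 3%N \notin iwrites P ->
  ivar s y = n -> ivar s 3 = 1 ->
  I 0%N (set_ivar s x 0) ->
  (forall i s', (i < n)%N -> agree (For x y P) s s' -> ivar s' x = i -> I i s' ->
     runs P s' B (fun s'' => I i.+1 (set_ivar s'' x i.+1))) ->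
  (forall s', agree (For x y P) s s' -> I n s' -> Q s') ->
  runs (For x y P) s (n * (B + 2) + 2) Q.
Proof.
rewrite !inE !negb_or => /and3P[xy x3 xP] yP P3 yn s3 I0 step fin.
have ag0 : agree (For x y P) s (set_ivar s x 0).
  by apply/agree_seql/(@exec_agree (Do (IConst x 0)))/ExecDo.
have -> : (n * (B + 2) + 2 = 1 + (n * (B + 2) + 1))%N by lia.
apply: runs_seq.
exists 1%N, (set_ivar s x 0); split=> //; first exact: ExecDo.
have yF : y \notin iwrites (For x y P).
  have := yP; rewrite /iwrites/=; case: (writes P) => [[[a b] c] d]/=.
  by rewrite !(inE, mem_cat) !negb_or eq_sym xy/= => ->.
have F3 : 3%N \notin iwrites (For x y P).
  have := P3; rewrite /iwrites/=; case: (writes P) => [[[a b] c] d]/=.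
  by rewrite !(inE, mem_cat) !negb_or eq_sym x3/= => ->.
have xx : ivar (set_ivar s x 0) x = 0%N by rewrite /= /upd eqxx.
(* Induction on the number [d] of rounds left. *)
suff main d : forall i s1, (n - i)%N = d -> (i <= n)%N ->
    agree (For x y P) s s1 -> ivar s1 x = i -> I i s1 ->
    runs (While (ILt x y) (Seq P (Do (IAdd x x 3)))) s1 (d * (B + 2) + 1) Q.
  by apply: (main n 0%N) => //; rewrite subn0.
elim: d => [|d IH] i s1 di le_in ag1 x1 I1.
  have ni : n = i by lia.
  exists 1%N, s1; split => //.
  - apply: ExecWhileF; rewrite /= (agree_ivar ag1 yF) x1 yn ni; exact: ltnn.
  - by apply: fin => //; rewrite ni.
have [] := runs_agree (step i s1 _ ag1 x1 I1); first lia.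
move=> T [s2 [e2 lT [ag2 I2]]].
have x2 : ivar s2 x = i by rewrite (agree_ivar ag2).
have s23 : ivar s2 3 = 1%N by rewrite (agree_ivar ag2)// (agree_ivar ag1).
have e3 : exec (Seq P (Do (IAdd x x 3))) s1 (T + 1) (set_ivar s2 x i.+1).
  apply: ExecSeq e2 _.
  have -> : set_ivar s2 x i.+1 = run_instr (IAdd x x 3) s2.
    by rewrite /= x2 s23 addn1.
  exact: ExecDo.
have ag3 : agree (For x y P) s (set_ivar s2 x i.+1).
  by apply: agree_trans ag1 _; apply/agree_seqr; exact: (exec_agree e3).
have [|||T2 [s3' [e4 l4 q]]] := IH i.+1 (set_ivar s2 x i.+1) _ _ ag3 _ I2.
- lia.
- lia.
- by rewrite /= /upd eqxx.
exists (T + 1 + T2).+1, s3'; split=> //.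
  apply: ExecWhileT e3 e4.
  by rewrite /= (agree_ivar ag1 yF) x1 yn; lia.
rewrite mulSn; lia.
Qed.

Lemma runs_step l P s B Q :
  (size l < B)%N -> runs P (run_block l s) (B - (size l).+1) Q ->
  runs (Seq (block l) P) s B Q.
Proof.
move=> lB H; rewrite -(subnKC lB).
by apply: runs_seq; exact: runs_block.
Qed.

Lemma runs_last l s B Q :
  (size l < B)%N -> Q (run_block l s) -> runs (block l) s B Q.
Proof. by move=> lB H; apply: runs_weaken (runs_block H) lB _. Qed.

Lemma runs_test b P1 P2 s B Q :
  (0 < B)%N -> runs (if run_test b s then P1 else P2) s B.-1 Q ->
  runs (If b P1 P2) s B Q.
Proof. by case: B => // B _; exact: runs_if. Qed.

Lemma runs_comp B1 P1 P2 s B Q :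
  (B1 <= B)%N -> runs P1 s B1 (fun s1 => runs P2 s1 (B - B1) Q) ->
  runs (Seq P1 P2) s B Q.
Proof. by move=> lB H; rewrite -(subnKC lB); exact: runs_seq. Qed.

Lemma runs_call P1 P2 s B1 B Q1 Q :
  runs P1 s B1 Q1 -> (B1 <= B)%N ->
  (forall s1, agree P1 s s1 -> Q1 s1 -> runs P2 s1 (B - B1) Q) ->
  runs (Seq P1 P2) s B Q.
Proof.
move=> r1 lB r2; rewrite -(subnKC lB); apply: runs_seq.
by apply: runs_weaken (runs_agree r1) _ _ => // s1 [ag q]; exact: r2.
Qed.

End TimedLogic.

(** * Linear search for an extremal index *)

Section BestIndex.

(** The candidate, initially [x0], is replaced only by a strictly better index, exactly as in the
    loops of the program. *)
Fixpoint best_index (P : pred nat) (r : rel nat) (x0 i : nat) : nat :=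
  if i is j.+1 then
    let x := best_index P r x0 j in if P j && ~~ r x j then j else x
  else x0.

Variables (P : pred nat) (r : rel nat) (x0 : nat).

Lemma best_index_P i : P x0 -> P (best_index P r x0 i).
Proof. by move=> P0; elim: i => //= i IH; case: ifP => // /andP[]. Qed.

Lemma best_index_lt n i : (x0 < n)%N -> (i <= n)%N -> (best_index P r x0 i < n)%N.
Proof. by move=> x0n; elim: i => //= i IH lt_in; case: ifP => // _; exact/IH/ltnW. Qed.

Lemma best_indexP n j : reflexive r -> transitive r -> total r ->
  (j < n)%N -> P j -> r (best_index P r x0 n) j.
Proof.
move=> rr rt rT; elim: n => // n IH; rewrite ltnS leq_eqVlt => /predU1P[->|jn] Pj /=.
  by rewrite Pj; case: ifP => [//|/negbFE].
case: ifP => [/andP[_ nr]|_]; last exact: IH.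
apply: (rt (best_index P r x0 n)); last exact: IH.
by have /orP[h|//] := rT (best_index P r x0 n) n; rewrite h in nr.
Qed.

End BestIndex.

(** * The greedy procedure with guesses and its approximation factor *)

Section Greedy.

Variables (R : realType) (n k : nat) (D : nat -> nat -> R) (cl fc : pred nat).
Variables (rad : nat -> R) (f0 c0 : nat).

Definition nearest c := best_index fc (fun x y => D x c <= D y c) f0 n.

Definition farthest (m : nat -> R) := best_index cl (fun x y => m y <= m x) c0 n.

(** The current relative distances to the chosen clients, the client to be
    treated next, and the centers of the balls. *)
Definition greedy_state := ((nat -> R) * nat * (nat -> nat))%type.

(** The distance to the client [c] is measured in units of the radius [u] of the ball guessed for
    [c]. *)
Definition shrink (m : nat -> R) c u p := Num.min (m p) (D p c / u).

Definition greedy_step (a : greedy_state) (d : nat) : greedy_state :=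
  let m := shrink a.1.1 a.1.2 (rad d) in
  (m, farthest m, upd a.2 d (nearest a.1.2)).

(** The base-[k] digits of [code] are the guesses of the balls covering the
    successive clients. *)
Fixpoint greedy_run (i code : nat) (a : greedy_state) : greedy_state :=
  if i is j.+1 then greedy_run j (code %/ k) (greedy_step a (code %% k)) else a.

(** Since the radii are at least 1, the initial relative distances are
    overwritten by the first step. *)
Definition greedy_start : greedy_state := (fun p => D p c0, c0, fun=> f0).

Definition covers (cen : nat -> nat) (B : R) :=
  forall p, (p < n)%N -> cl p -> exists2 l, (l < k)%N & D p (cen l) <= B * rad l.

Definition facility_centers (cen : nat -> nat) :=
  forall l, (l < k)%N -> (cen l < n)%N /\ fc (cen l).

Hypothesis k_gt0 : (0 < k)%N.
Hypothesis f0_lt : (f0 < n)%N.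
Hypothesis f0_fc : fc f0.
Hypothesis c0_lt : (c0 < n)%N.
Hypothesis c0_cl : forall p, (p < n)%N -> cl p -> cl c0.
Hypothesis rad_ge1 : forall l, (l < k)%N -> 1 <= rad l.
Hypothesis D_ge0 : forall p q, 0 <= D p q.
Hypothesis D_sym : forall p q, (p < n)%N -> (q < n)%N -> D p q = D q p.
Hypothesis D_triangle : forall p q r,
  (p < n)%N -> (q < n)%N -> (r < n)%N -> D p r <= D p q + D q r.

Lemma nearest_lt c : (nearest c < n)%N.
Proof. exact: best_index_lt. Qed.

Lemma nearest_fc c : fc (nearest c).
Proof. exact: best_index_P. Qed.

Lemma nearestP c q : (q < n)%N -> fc q -> D (nearest c) c <= D q c.
Proof.
move=> qn fq.
apply: (best_indexP (r := fun x y => D x c <= D y c)) qn fq => //.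
- by move=> y x z; exact: le_trans.
- by move=> x y; exact: le_total.
Qed.

Lemma farthest_lt m : (farthest m < n)%N.
Proof. exact: best_index_lt. Qed.

Lemma farthest_cl m p : (p < n)%N -> cl p -> cl (farthest m).
Proof.
by move=> pn clp; exact/best_index_P/c0_cl/clp.
Qed.

Lemma farthestP m q : (q < n)%N -> cl q -> m q <= m (farthest m).
Proof.
move=> qn fq.
apply: (best_indexP (r := fun x y => m y <= m x)) qn fq => //.
- by move=> y x z h1 h2; exact: le_trans h2 h1.
- by move=> x y; exact: le_total.
Qed.

Lemma greedy_step_facility a d :
  facility_centers a.2 -> facility_centers (greedy_step a d).2.
Proof.
move=> h l lk; rewrite /= /upd; case: eqP => _; last exact: h.
by rewrite nearest_lt nearest_fc.
Qed.

Lemma greedy_run_facility i code a :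
  facility_centers a.2 -> facility_centers (greedy_run i code a).2.
Proof. by elim: i code a => //= i IH code a h; exact/IH/greedy_step_facility. Qed.

Variables (delta alpha : R) (o : nat -> nat).
Hypothesis delta_ge0 : 0 <= delta.
Hypothesis alpha_ge0 : 0 <= alpha.
Hypothesis near_delta : forall c q, (c < n)%N -> cl c -> (q < n)%N -> fc q ->
  D (nearest c) c <= delta * D q c.
Hypothesis opt_facility : facility_centers o.
Hypothesis opt_covers : covers o alpha.

Let bound := (2 + delta) * alpha.

(** The final phase: the balls in [U] already cover all clients, so the remaining guesses may be any
    balls outside [U]. *)
Definition frozen (U : {set 'I_k}) (cen : nat -> nat) :=
  forall p, (p < n)%N -> cl p ->
    exists2 l : 'I_k, l \in U & D p (cen l) <= bound * rad l.

(** The balls in [U] have been guessed correctly: [b l] is a client in the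
    optimal ball [l]. *)
Record active (U : {set 'I_k}) (b : nat -> nat) (a : greedy_state) : Prop := Active {
  active_ball : forall l : 'I_k, l \in U ->
    [/\ (b l < n)%N, cl (b l), D (o l) (b l) <= alpha * rad l &
        a.2 l = nearest (b l)] ;
  active_next : (a.1.2 < n)%N /\ cl a.1.2 ;
  active_far : U != finset.set0 -> forall p, (p < n)%N -> cl p -> a.1.1 p <= a.1.1 a.1.2 ;
  active_ub : forall p, (p < n)%N -> cl p ->
    (U = finset.set0 /\ a.1.1 p = D p a.1.2) \/
    exists2 l : 'I_k, l \in U & D p (b l) <= a.1.1 p * rad l ;
  active_lb : forall l : 'I_k, l \in U -> forall p, (p < n)%N -> a.1.1 p * rad l <= D p (b l) }.

Lemma rad_gt0 (l : 'I_k) : 0 < rad l.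
Proof. by apply: lt_le_trans (rad_ge1 (ltn_ord l)). Qed.

Lemma active_near (U : {set 'I_k}) b a (l : 'I_k) : active U b a -> l \in U ->
  D (a.2 l) (b l) <= delta * (alpha * rad l).
Proof.
move=> act lU; have [bn clb ob ->] := active_ball act lU.
have [on fo] := opt_facility (ltn_ord l).
by apply: le_trans (near_delta bn clb on fo) _; exact: ler_wpM2l.
Qed.

Lemma active_center_lt (U : {set 'I_k}) b a (l : 'I_k) : active U b a -> l \in U -> (a.2 l < n)%N.
Proof. by move=> act lU; have [_ _ _ ->] := active_ball act lU; exact: nearest_lt. Qed.

Lemma frozen_step (U : {set 'I_k}) a (l : 'I_k) :
  l \notin U -> frozen U a.2 -> frozen (l |: U)%SET (greedy_step a l).2.
Proof.
move=> lU fr p pn clp; have [l' l'U h] := fr p pn clp.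
exists l'; first by rewrite !inE l'U orbT.
rewrite /= upd_neq//; apply: contraNneq lU => /val_inj e; by rewrite -e.
Qed.

(** Dichotomy on the relative distance of the next client, compared with [2 * alpha]. For nonempty
    [U], [active_ub] and [active_lb] say that the stored value of a client is its least relative
    distance to the clients [b l]. *)
Lemma active_step (U : {set 'I_k}) b a : active U b a ->
  frozen U a.2 \/
  exists2 l : 'I_k, l \notin U & active (l |: U)%SET (upd b l a.1.2) (greedy_step a l).
Proof.
move=> act; have [cn clc] := active_next act.
have [/andP[U0 mc]|big] := boolP ((U != finset.set0) && (a.1.1 a.1.2 <= 2 * alpha)).
  (* Every client is within [2 * alpha * rad l] of some [b l], and the center of [l] is within
     [delta * alpha * rad l] of [b l]. *)
  left=> p pn clp; have [[U0']|[l lU h]] := active_ub act pn clp.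
    by rewrite U0' eqxx in U0.
  exists l => //; have [bn _ _ _] := active_ball act lU.
  have cenn := active_center_lt act lU.
  have near := active_near act lU.
  have mp := le_trans (active_far act U0 pn clp) mc.
  apply: le_trans (D_triangle pn bn cenn) _.
  rewrite /bound mulrDl mulrDl; apply: lerD; last by rewrite D_sym// -mulrA.
  by apply: le_trans h _; rewrite ler_wpM2r// ltW// rad_gt0.
right; have [l lk ol] := opt_covers cn clc.
have [on fo] := opt_facility lk.
(* Had this ball been guessed before, the next client and the client [b l] would lie in the same
   optimal ball, at distance at most [2 * alpha * rad l], against [big]. *)
have lU : Ordinal lk \notin U.
  apply: contra big => lU; apply/andP; split.
    by apply/set0Pn; exists (Ordinal lk).
  have [bn _ ob _] := active_ball act lU.
  rewrite -(ler_pM2r (rad_gt0 (Ordinal lk))).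
  apply: le_trans (active_lb act lU cn) _.
  apply: le_trans (D_triangle cn on bn) _.
  by rewrite mulrDl mul1r mulrDl; exact: lerD.
exists (Ordinal lk) => //; split.
- move=> l' /=; rewrite /upd; case: eqP => [-> _|/eqP l'l].
    by split=> //; rewrite D_sym.
  rewrite !inE => /orP[/eqP e|l'U]; first by rewrite e eqxx in l'l.
  by have [] := active_ball act l'U.
- by split; [exact: farthest_lt|exact: farthest_cl clc].
- by move=> _ p pn clp; exact: farthestP.
- move=> p pn clp; right.
  rewrite /= /shrink; have [le1|le1] := leP (a.1.1 p) (D p a.1.2 / rad l).
    (* In the first round the stored value is the plain distance, which multiplication by a radius
       of at least 1 does not decrease. *)
    have [[U0 mp]|[l' l'U h]] := active_ub act pn clp.
      exists (Ordinal lk); first by rewrite !inE eqxx.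
      by rewrite /= /upd eqxx mp ler_peMr// rad_ge1.
    exists l'; first by rewrite !inE l'U orbT.
    rewrite upd_neq//; apply: contraNneq lU => e.
    by have <- : l' = Ordinal lk by exact: val_inj.
  exists (Ordinal lk); first by rewrite !inE eqxx.
  by rewrite /= /upd eqxx divfK// lt0r_neq0// (rad_gt0 (Ordinal lk)).
- move=> l' l'U p pn /=; rewrite /upd; case: eqP => [e|/eqP l'l].
    rewrite e -ler_pdivlMr ?(rad_gt0 (Ordinal lk))//.
    by rewrite ge_min lexx orbT.
  move: l'U; rewrite !inE => /orP[/eqP e|l'U]; first by rewrite e eqxx in l'l.
  apply: le_trans (active_lb act l'U pn).
  by rewrite ler_wpM2r ?(ltW (rad_gt0 l'))// ge_min lexx.
Qed.

Lemma active_start : cl c0 -> active finset.set0 (fun=> 0%N) greedy_start.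
Proof.
move=> clc; split => //.
- by move=> l; rewrite inE.
- by rewrite eqxx.
- by move=> p pn clp; left.
- by move=> l; rewrite inE.
Qed.

(** Induction on the number [i] of digits left, one new ball joining [U] per digit. The digit read
    first is the least significant one, so the code of the remaining rounds is multiplied by [k]. *)
Lemma greedy_complete i (U : {set 'I_k}) a :
  (#|U| + i = k)%N -> frozen U a.2 \/ (exists b, active U b a) ->
  exists2 code, (code < k ^ i)%N & covers (greedy_run i code a).2 bound.
Proof.
elim: i U a => [|i IH] U a Ui inv.
  exists 0%N => // p pn clp /=.
  have [fr|[b act]] := inv; first by have [l _ h] := fr p pn clp; exists l.
  (* All balls have been guessed, so the optimal ball [l] of [p] is in [U]. The path from [p]
     through [o l] and [b l] to the center of [l] has length at most
     [(2 + delta) * alpha * rad l]. *)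
  have [l lk h] := opt_covers pn clp; exists l => //.
  have lU : Ordinal lk \in U.
    suff -> : U = [set: 'I_k]%SET by rewrite inE.
    by apply/eqP; rewrite eqEcard finset.subsetT cardsT card_ord; lia.
  have [bn _ ob _] := active_ball act lU.
  have cenn := active_center_lt act lU.
  have [on _] := opt_facility lk.
  have near := active_near act lU.
  apply: le_trans (D_triangle pn on cenn) _.
  have := D_triangle on bn cenn; rewrite [D (b _) _]D_sym// => tri.
  rewrite /bound (_ : (2 + delta) * alpha * rad l =
    alpha * rad l + (alpha * rad l + delta * (alpha * rad l))); last by ring.
  apply: lerD; first by [].
  by apply: le_trans tri _; exact: lerD.
suff [l lU inv'] : exists2 l : 'I_k, l \notin U &
    frozen (l |: U)%SET (greedy_step a l).2 \/ (exists b, active (l |: U)%SET b (greedy_step a l)).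
  have [|code codelt cov] := IH (l |: U)%SET (greedy_step a l) _ inv'.
    by rewrite cardsU1 lU add1n addSnnS.
  exists (code * k + l)%N.
    by rewrite expnS; have := ltn_ord l; nia.
  by rewrite /= divnMDl// divn_small// addn0 modnMDl modn_small.
have [fr|[l lU act]] : frozen U a.2 \/ exists2 l : 'I_k, l \notin U &
    exists b, active (l |: U)%SET b (greedy_step a l).
  have [|[b act]] := inv; first by left.
  have [|[l lU act']] := active_step act; first by left.
  by right; exists l => //; exists (upd b l a.1.2).
  have /subsetPn[l _ lU] : ~~ ([set: 'I_k]%SET \subset U).
    by apply/negP => /subset_leq_card; rewrite cardsT card_ord; lia.
  by exists l => //; left; exact: frozen_step.
by exists l => //; right.
Qed.

Theorem greedy_approx :
  exists2 code, (code < k ^ k)%N & covers (greedy_run k code greedy_start).2 bound.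
Proof.
apply: (greedy_complete (U := finset.set0)); first by rewrite cards0.
(* If [c0] is not a client there are no clients, and the empty set of balls is vacuously frozen. *)
have [clc|nclc] := boolP (cl c0).
  by right; exists (fun=> 0%N); exact: active_start.
by left=> p pn clp; rewrite (c0_cl pn clp) in nclc.
Qed.

End Greedy.

(** * The program and its memory layout *)

(** Index variables 0-2 are the input, 3 and 4 hold 1 and 0, 5 holds k - 1,
    6 and 8 a facility f0 and a client c0 (if there is one), 7 the row offset
    f0 * n, 9 the number k ^ k of codes, 10 the code, 11 its digits not yet
    read, 15 the current digit, 16 the client to be treated. Integer array 4
    and real arrays 2 and 3 hold the centers, the radii of the k balls and the
    relative distances. There is no index multiplication, so distance entries
    are addressed by adding n to an offset (index variable 18). *)
Definition take_digit : program :=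
  Seq (block [:: IConst 13 0; IAdd 15 11 4; IAdd 19 11 4])
  (Seq (For 14 19
         (If (ILt 5 15) (block [:: ISub 15 15 2; IAdd 13 13 3]) (block [::])))
       (block [:: IAdd 11 13 4])).

(** The offset in index variable 18 runs down the column of the client in index variable 16. Adding
    index variable 4, which holds 0, serves as a copy. *)
Definition place_center : program :=
  Seq (block [:: IAdd 20 6 4; IAdd 18 7 16; RLoad 3 0 18; IAdd 18 16 4])
  (Seq (For 17 0
         (Seq (block [:: ILoad 19 2 17])
         (Seq (If (ILt 4 19)
                (Seq (block [:: RLoad 2 0 18])
                     (If (RLe 3 2) (block [::]) (block [:: RLoad 3 0 18; IAdd 20 17 4])))
                (block [::]))
              (block [:: IAdd 18 18 0]))))
       (block [:: IStore 4 15 20])).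

Definition shrink_distances : program :=
  Seq (block [:: IAdd 18 16 4; RLoad 1 2 15])
      (For 17 0
        (Seq (block [:: RLoad 2 0 18; RDiv 2 2 1; RLoad 4 3 17])
        (Seq (If (RLe 4 2) (block [::]) (block [:: RStore 3 17 2]))
             (block [:: IAdd 18 18 0])))).

Definition find_farthest : program :=
  Seq (block [:: IAdd 16 8 4; RLoad 5 3 8])
      (For 17 0
        (Seq (block [:: ILoad 19 1 17])
             (If (ILt 4 19)
               (Seq (block [:: RLoad 4 3 17])
                    (If (RLe 4 5) (block [::]) (block [:: RLoad 5 3 17; IAdd 16 17 4])))
               (block [::])))).

Definition greedy_step_prog : program :=
  Seq take_digit (Seq place_center (Seq shrink_distances find_farthest)).

Definition greedy_prog : program :=
  Seq (block [:: IAdd 11 10 4; IAdd 16 8 4; IAdd 18 8 4])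
  (Seq (For 17 0 (block [:: RLoad 2 0 18; RStore 3 17 2; IAdd 18 18 0]))
  (Seq (For 12 2 (block [:: IStore 4 12 6]))
       (For 12 2 greedy_step_prog))).

(** The least dilation for the current centers: the maximum, starting from 0, over the clients of
    the minimum over the balls of distance divided by radius. Adding real variable 7, set to 0,
    copies a real. *)
Definition evaluate_prog : program :=
  Seq (block [:: RConst 6 0; IConst 18 0])
      (For 17 0
        (Seq (block [:: ILoad 19 4 4; IAdd 19 18 19; RLoad 2 0 19; RLoad 1 2 4; RDiv 2 2 1])
        (Seq (For 22 2
               (Seq (block [:: ILoad 19 4 22; IAdd 19 18 19; RLoad 4 0 19;
                               RLoad 1 2 22; RDiv 4 4 1])
                    (If (RLe 2 4) (block [::]) (block [:: RConst 7 0; RAdd 2 4 7]))))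
        (Seq (block [:: ILoad 19 1 17])
        (Seq (If (ILt 4 19)
               (If (RLe 2 6) (block [::]) (block [:: RConst 7 0; RAdd 6 2 7]))
               (block [::]))
             (block [:: IAdd 18 18 0])))))).

Definition copy_prog : program :=
  Seq (block [:: RConst 7 0; RAdd 0 6 7])
      (For 12 2 (block [:: ILoad 19 4 12; IStore 3 12 19])).

(** The outcome of code 0 is always copied, as there is no earlier one to compare it with. *)
Definition search_prog : program :=
  For 10 9
    (Seq greedy_prog
    (Seq evaluate_prog
         (If (ILt 4 10) (If (RLe 0 6) (block [::]) copy_prog) copy_prog))).

Definition expand_radii : program :=
  Seq (block [:: IConst 3 1; ISub 5 2 3; IConst 21 0])
      (For 12 1
        (Seq (block [:: ILoad 19 0 12; RLoad 1 1 12])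
             (For 14 19 (block [:: RStore 2 21 1; IAdd 21 21 3])))).

(** Keeps the last client and the last facility met; if there is none, the variable retains its
    initial value 0. *)
Definition find_defaults : program :=
  Seq (block [:: IConst 18 0])
      (For 17 0
        (Seq (block [:: ILoad 19 1 17])
        (Seq (If (ILt 4 19) (block [:: IAdd 8 17 4]) (block [::]))
        (Seq (block [:: ILoad 19 2 17])
        (Seq (If (ILt 4 19) (block [:: IAdd 6 17 4; IAdd 7 18 4]) (block [::]))
             (block [:: IAdd 18 18 0])))))).

Definition power_prog : program :=
  Seq (block [:: IConst 9 1])
      (For 12 2
        (Seq (block [:: IConst 13 0])
        (Seq (For 14 2 (block [:: IAdd 13 13 9]))
             (block [:: IAdd 9 13 4])))).

Definition nukc_prog : program :=
  Seq expand_radii (Seq find_defaults (Seq power_prog search_prog)).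

Arguments block : simpl never.

(** Symbolic evaluation of the cells after a block. *)
Ltac regs :=
  repeat match goal with x := run_block _ _ |- _ => progress rewrite /x end;
  rewrite ?/run_block /= ?/upd /=.

(** * Correctness and running time of the search over all codes *)

Section Correctness.

Variables (R : realType) (n k : nat) (ic ifc : nat -> nat) (dm rad : nat -> R).
Variables (f0 c0 : nat).

Let D (p q : nat) : R := dm (p * n + q)%N.
Let cl : pred nat := fun p => (0 < ic p)%N.
Let fc : pred nat := fun p => (0 < ifc p)%N.

Record env (s : state R) : Prop := Env {
  env0 : ivar s 0 = n ;
  env2 : ivar s 2 = k ;
  env3 : ivar s 3 = 1%N ;
  env4 : ivar s 4 = 0%N ;
  env5 : ivar s 5 = k.-1 ;
  env6 : ivar s 6 = f0 ;
  env7 : ivar s 7 = (f0 * n)%N ;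
  env8 : ivar s 8 = c0 ;
  env9 : ivar s 9 = (k ^ k)%N ;
  envc : iarr s 1 = ic ;
  envf : iarr s 2 = ifc ;
  envd : rarr s 0 = dm ;
  envr : rarr s 2 = rad }.

(** Boolean, so that for a concrete program it is settled by computation. *)
Definition preserves_env (P : program) : bool :=
  let: (a, b, c, d) := writes P in
  [&& all (fun x => x \notin a) [:: 0; 2; 3; 4; 5; 6; 7; 8; 9]%N,
      all (fun x => x \notin b) [:: 1; 2]%N &
      all (fun x => x \notin d) [:: 0; 2]%N].

Lemma env_agree P s s' : agree P s s' -> env s -> preserves_env P -> env s'.
Proof.
rewrite /agree /preserves_env; case: (writes P) => [[[a b] c] d] [h1 h2 _ h4].
case=> ? ? ? ? ? ? ? ? ? ? ? ? ? /and3P[/allP a0 /allP b0 /allP d0].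
by split; rewrite ?h1 ?h2 ?h4 ?inE//; auto.
Qed.

Lemma env_block l s : env s -> preserves_env (block l) -> env (run_block l s).
Proof.
move=> e; have [T [s' [ex _ ->]]] := runs_block (l := l) (s := s) (Q := eq (run_block l s)) erefl.
exact: env_agree (exec_agree ex) e.
Qed.

Hypothesis k_gt0 : (0 < k)%N.

Local Open Scope nat_scope.

Lemma take_digit_spec s : env s ->
  runs take_digit s (ivar s 11 * 6 + 20)
    (fun s' => ivar s' 15 = ivar s 11 %% k /\ ivar s' 11 = ivar s 11 %/ k).
Proof.
move=> e; apply: runs_step; first by rewrite /=; lia.
set s1 := run_block _ _; have e1 : env s1 by exact: env_block.
apply: (runs_call (Q1 := fun s' => ivar s 11 = ivar s' 13 * k + ivar s' 15 /\ ivar s' 15 < k)).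
(* Division by repeated subtraction: the quotient grows in every round until the remainder is below
   [k]. Since [k] is positive, as many rounds as the dividend suffice. *)
- apply: (runs_for (B := 4) (n := ivar s 11) (I := fun i s' =>
    ivar s 11 = ivar s' 13 * k + ivar s' 15 /\ (i <= ivar s' 13 \/ ivar s' 15 < k))) => //.
  + by regs; rewrite (env4 e) addn0.
  + exact: env3.
  + by regs; rewrite (env4 e) addn0; split; [|left].
  + move=> i s2 lt_i ag si [h1 h2].
    have e2 := env_agree ag e1 isT.
    apply: runs_test => //=; rewrite (env5 e2).
    case: ltnP => hlt; apply: runs_last => //; regs.
      rewrite (env2 e2) (env3 e2); split; last by left; lia.
      by rewrite mulnDl; lia.
    by split => //; right; lia.
  + move=> s2 ag [h1 h2]; split => //; case: h2 => // h2; nia.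
- rewrite /=; lia.
- move=> s2 ag [h1 h2]; have e2 := env_agree ag e1 isT.
  apply: runs_last; first by rewrite /=; lia.
  regs; rewrite (env4 e2) addn0 h1 divnMDl// modnMDl modn_small// divn_small//.
  by rewrite addn0.
Qed.

Lemma place_center_spec s : env s ->
  runs place_center s (n * 20 + 20)
    (fun s' => iarr s' 4 = upd (iarr s 4) (ivar s 15) (nearest n D fc f0 (ivar s 16))).
Proof.
move=> e; apply: runs_step; first by rewrite /=; lia.
set s1 := run_block _ _; have e1 : env s1 by exact: env_block.
pose b := best_index fc (fun x y => D x (ivar s 16) <= D y (ivar s 16))%R f0.
have bS i : b i.+1 = if fc i && ~~ (D (b i) (ivar s 16) <= D i (ivar s 16))%R
  then i else b i by [].
apply: (runs_call (Q1 := fun s' => ivar s' 20 = b n)).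
- apply: (runs_for (B := 15) (n := n) (I := fun i s' =>
    [/\ ivar s' 20 = b i, ivar s' 18 = i * n + ivar s 16 &
        rvar s' 3 = D (b i) (ivar s 16)])) => //.
  + by rewrite env0.
  + exact: env3.
  + by regs; rewrite (env4 e) (env7 e) (env6 e) (envd e) !addn0.
  + move=> i s2 lt_i ag si [h1 h2 h3].
    have e2 := env_agree ag e1 isT.
    apply: runs_step => //.
    apply: (runs_comp (B1 := 10)) => //.
    apply: runs_test => //=; regs; rewrite (env4 e2) (envf e2) si -/(fc i).
    have [fci|nfci] := boolP (fc i); last first.
      apply: runs_last => //; apply: runs_last => //; regs.
      by rewrite h1 h2 h3 (env0 e2) bS (negPf nfci) mulSnr addnAC.
    apply: runs_step => //; apply: runs_test => //=; regs.
    rewrite (envd e2) h2 h3 -[dm _]/(D i (ivar s 16)).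
    rewrite bS fci; case: ifP => _; apply: runs_last => //; apply: runs_last => //; regs;
      by rewrite ?h1 ?h2 ?h3 ?(env0 e2) ?(env4 e2) ?(envd e2) ?si ?mulSnr ?addn0 addnAC.
  + by move=> s2 ag [].
- rewrite /=; lia.
- move=> s2 ag h; have e2 := env_agree ag e1 isT.
  apply: runs_last; first by rewrite /=; lia.
  regs; rewrite (agree_ivar ag)// [iarr s2 4](agree_iarr ag)// h.
  by regs.
Qed.

Lemma shrink_spec s : env s ->
  runs shrink_distances s (n * 20 + 20)
    (fun s' => forall p, rarr s' 3 p =
       if p < n then shrink D (rarr s 3) (ivar s 16) (rad (ivar s 15)) p else rarr s 3 p).
Proof.
move=> e; apply: runs_step; first by rewrite /=; lia.
set s1 := run_block _ _; have e1 : env s1 by exact: env_block.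
apply: (runs_leq (B := n * (15 + 2) + 2)); first by rewrite /=; lia.
apply: (runs_for (n := n) (I := fun i s' =>
    [/\ ivar s' 18 = i * n + ivar s 16, rvar s' 1 = rad (ivar s 15) &
       forall p, rarr s' 3 p =
       if p < i then shrink D (rarr s 3) (ivar s 16) (rad (ivar s 15)) p else rarr s 3 p])) => //.
- by rewrite env0.
- exact: env3.
- by regs; rewrite (env4 e) (envr e) !addn0.
- move=> i s2 lt_i ag si [h1 h2 h3].
  have e2 := env_agree ag e1 isT.
  apply: runs_step => //.
  apply: (runs_comp (B1 := 6)) => //.
  apply: runs_test => //=; regs; rewrite (envd e2) h1 h2 h3 si ltnn.
  rewrite -[dm _]/(D i (ivar s 16)).
  case: leP => hle; apply: runs_last => //; apply: runs_last => //; regs.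
    rewrite h1 h2 (env0 e2) mulSnr addnAC; split=> // p.
    rewrite ltnS leq_eqVlt h3; case: eqP => [->|_]//=.
    by rewrite ltnn /shrink min_l.
  rewrite h1 h2 (env0 e2) mulSnr addnAC; split=> // p.
  rewrite ltnS leq_eqVlt h3 si; case: eqP => [->|_]//=.
  by rewrite /shrink min_r// ltW.
- by move=> s2 ag [].
Qed.

Lemma find_farthest_spec m s : env s -> c0 < n ->
  (forall p, p < n -> rarr s 3 p = m p) ->
  runs find_farthest s (n * 20 + 20) (fun s' => ivar s' 16 = farthest n cl c0 m).
Proof.
move=> e c0n ms; apply: runs_step; first by rewrite /=; lia.
set s1 := run_block _ _; have e1 : env s1 by exact: env_block.
pose b := best_index cl (fun x y => m y <= m x)%R c0.
have bS i : b i.+1 = if cl i && ~~ (m i <= m (b i))%R then i else b i by [].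
apply: (runs_leq (B := n * (15 + 2) + 2)); first by rewrite /=; lia.
apply: (runs_for (n := n) (I := fun i s' => ivar s' 16 = b i /\ rvar s' 5 = m (b i))) => //.
- by rewrite env0.
- exact: env3.
- by regs; rewrite (env4 e) (env8 e) addn0 ms.
- move=> i s2 lt_i ag si [h1 h2].
  have e2 := env_agree ag e1 isT.
  have m2 : rarr s2 3 i = m i.
    by rewrite (agree_rarr ag)//; exact: ms.
  apply: runs_step => //.
  apply: runs_test => //=; regs; rewrite (env4 e2) (envc e2) si -/(cl i).
  have [cli|ncli] := boolP (cl i); last first.
    by apply: runs_last => //; regs; rewrite bS (negPf ncli).
  apply: runs_step => //; apply: runs_test => //=; regs.
  rewrite si m2 h2 bS cli; case: (m i <= m (b i))%R; apply: runs_last => //; regs.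
  by rewrite si (env4 e2) addn0 m2.
- by move=> s2 ag [].
Qed.

(** The arrays match the abstract state only below [n] and [k]. The term [ivar s 11 * 6] pays for
    the division by subtraction. *)
Lemma greedy_step_spec m c cen s : env s -> c0 < n ->
  (forall p, p < n -> rarr s 3 p = m p) -> ivar s 16 = c ->
  (forall l, l < k -> iarr s 4 l = cen l) ->
  let a := greedy_step n D cl fc rad f0 c0 (m, c, cen) (ivar s 11 %% k) in
  runs greedy_step_prog s (ivar s 11 * 6 + n * 60 + 80)
    (fun s' => [/\ ivar s' 11 = ivar s 11 %/ k,
       forall p, p < n -> rarr s' 3 p = a.1.1 p, ivar s' 16 = a.1.2 &
       forall l, l < k -> iarr s' 4 l = a.2 l]).
Proof.
move=> e c0n ms cs cens /=.
apply: (runs_call (take_digit_spec e)) => [|s1 ag1 [s1_15 s1_11]]; first lia.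
have e1 := env_agree ag1 e isT.
apply: (runs_call (place_center_spec e1)) => [|s2 ag2 s2_4]; first lia.
have e2 := env_agree ag2 e1 isT.
apply: (runs_call (shrink_spec e2)) => [|s3 ag3 s3_3]; first lia.
have e3 := env_agree ag3 e2 isT.
have s2_3 p : p < n -> rarr s2 3 p = m p.
  by move=> pn; rewrite (agree_rarr ag2)// (agree_rarr ag1)// ms.
have c2 : ivar s2 16 = c by rewrite (agree_ivar ag2)// (agree_ivar ag1).
have d2 : ivar s2 15 = ivar s 11 %% k by rewrite (agree_ivar ag2).
have ms3 p : p < n -> rarr s3 3 p = shrink D m c (rad (ivar s 11 %% k)) p.
  by move=> pn; rewrite s3_3 pn c2 d2 /shrink s2_3.
apply: (runs_weaken (runs_agree (find_farthest_spec e3 c0n ms3))); first lia.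
move=> s4 [ag4 s4_16]; split => //.
- by rewrite (agree_ivar ag4)// (agree_ivar ag3)// (agree_ivar ag2).
- by move=> p pn; rewrite (agree_rarr ag4)// ms3.
- move=> l lk; rewrite (agree_iarr ag4)// (agree_iarr ag3)// s2_4.
  rewrite s1_15 (agree_ivar ag1)// cs (agree_iarr ag1)// /upd.
  by case: eqP => // _; exact: cens.
Qed.

Definition run_code (code : nat) : nat -> nat :=
  (greedy_run n k D cl fc rad f0 c0 k code (greedy_start D f0 c0)).2.

Lemma greedy_prog_spec s : env s -> c0 < n -> ivar s 10 < k ^ k ->
  runs greedy_prog s (k * (k ^ k * 6 + n * 60 + 90) + n * 10 + 30)
    (fun s' => forall l, l < k -> iarr s' 4 l = run_code (ivar s 10) l).
Proof.
move=> e c0n code_lt; apply: runs_step; first by rewrite /=; lia.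
set s1 := run_block _ _; have e1 : env s1 by exact: env_block.
apply: (runs_call (Q1 := fun s' => forall p, p < n -> rarr s' 3 p = D p c0)).
- apply: (runs_for (B := 5) (n := n) (I := fun i s' => ivar s' 18 = i * n + c0 /\
    forall p, p < i -> rarr s' 3 p = D p c0)) => //.
  + by rewrite env0.
  + exact: env3.
  + by regs; rewrite (env4 e) (env8 e) addn0.
  + move=> i s2 lt_i ag si [h1 h2]; have e2 := env_agree ag e1 isT.
    apply: runs_last => //; regs; rewrite h1 (env0 e2) mulSnr addnAC; split=> // p.
    rewrite ltnS leq_eqVlt si (envd e2).
    by case: eqP => [->|_]//=; exact: h2.
  + by move=> s2 ag [].
- rewrite /=; lia.
move=> s2 ag2 m2; have e2 := env_agree ag2 e1 isT.
apply: (runs_call (Q1 := fun s' => forall l, l < k -> iarr s' 4 l = f0)).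
- apply: (runs_for (B := 3) (n := k) (I := fun i s' =>
    forall l, l < i -> iarr s' 4 l = f0)) => //.
  + by rewrite env2.
  + exact: env3.
  + move=> i s3 lt_i ag si h; have e3 := env_agree ag e2 isT.
    apply: runs_last => //; regs; rewrite si (env6 e3) => l.
    by rewrite ltnS leq_eqVlt; case: eqP => [->|_]//=; exact: h.
- rewrite /=; nia.
move=> s3 ag3 cen3; have e3 := env_agree ag3 e2 isT.
have c3 : ivar s3 16 = c0.
  by rewrite (agree_ivar ag3)// (agree_ivar ag2)//; regs; rewrite (env4 e) (env8 e) addn0.
have code3 : ivar s3 11 = ivar s 10.
  by rewrite (agree_ivar ag3)// (agree_ivar ag2)//; regs; rewrite (env4 e) addn0.
have m3 p : p < n -> rarr s3 3 p = D p c0.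
  by move=> pn; rewrite (agree_rarr ag3)// m2.
apply: (runs_leq (B := k * (k ^ k * 6 + n * 60 + 80 + 2) + 2)); first by rewrite /=; nia.
(* The abstract state [a] is characterized by what the remaining [k - i] rounds make of it. The
   bound on the remaining code controls the time for the next digit. *)
apply: (runs_for (n := k) (I := fun i s' => exists a,
  [/\ forall p, p < n -> rarr s' 3 p = a.1.1 p, ivar s' 16 = a.1.2,
      forall l, l < k -> iarr s' 4 l = a.2 l, ivar s' 11 < k ^ k &
      run_code (ivar s 10) =
        (greedy_run n k D cl fc rad f0 c0 (k - i) (ivar s' 11) a).2])) => //.
- by rewrite env2.
- exact: env3.
- exists (greedy_start D f0 c0); split=> //; regs; rewrite ?code3//.
  by rewrite subn0.
- move=> i s4 lt_i ag si [[[m c] cen] [h1 h2 h3 h4 h5]].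
  have e4 := env_agree ag e3 isT.
  apply: (runs_weaken (greedy_step_spec e4 c0n h1 h2 h3)); first lia.
  move=> s5 [g1 g2 g3 g4].
  exists (greedy_step n D cl fc rad f0 c0 (m, c, cen) (ivar s4 11 %% k)).
  regs; rewrite g1; split=> //.
    exact: leq_ltn_trans (leq_div _ _) h4.
  by rewrite h5 (_ : k - i = (k - i.+1).+1)//; lia.
- move=> s4 ag [a [_ _ h3 _ ->]] l lk.
  by rewrite subnn /= h3.
Qed.

(** The running maximum starts at 0, so it is minimal among the nonnegative dilations that cover. *)
Lemma evaluate_spec cen s : env s ->
  (forall l, l < k -> iarr s 4 l = cen l) -> (forall l, l < k -> (0 < rad l)%R) ->
  (forall p q, 0 <= D p q)%R ->
  runs evaluate_prog s (n * (k * 15 + 40) + 10)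
    (fun s' => [/\ (0 <= rvar s' 6)%R, covers n k D cl rad cen (rvar s' 6) &
      forall B, (0 <= B)%R -> covers n k D cl rad cen B -> (rvar s' 6 <= B)%R]).
Proof.
move=> e cens rad_gt0 D_ge0; apply: runs_step; first by rewrite /=; lia.
set s1 := run_block _ _; have e1 : env s1 by exact: env_block.
have cen1 l : l < k -> iarr s1 4 l = cen l by regs; exact: cens.
apply: (runs_leq (B := n * (k * 15 + 35 + 2) + 2)); first by rewrite /=; lia.
apply: (runs_for (n := n) (I := fun i s' => [/\ ivar s' 18 = i * n, (0 <= rvar s' 6)%R,
   covers i k D cl rad cen (rvar s' 6) &
   forall B, (0 <= B)%R -> covers n k D cl rad cen B -> (rvar s' 6 <= B)%R])) => //.
- by rewrite env0.
- exact: env3.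
2: by move=> s2 _ [].
move=> i s2 lt_i ag2 si [h1 h2 h3 h4]; have e2 := env_agree ag2 e1 isT.
have cen2 l : l < k -> iarr s2 4 l = cen l.
  by move=> lk; rewrite (agree_iarr ag2)// cen1.
apply: runs_step; first by rewrite /=; lia.
set s3 := run_block _ _; have e3 : env s3 by exact: env_block.
apply: (runs_call (Q1 := fun s' => (exists2 l, l < k & rvar s' 2 = (D i (cen l) / rad l)%R)
  /\ forall l, l < k -> (rvar s' 2 <= D i (cen l) / rad l)%R)).
- apply: (runs_for (B := 13) (n := k) (I := fun j s' =>
    (exists2 l, l < k & rvar s' 2 = (D i (cen l) / rad l)%R)
    /\ forall l, l < j -> (rvar s' 2 <= D i (cen l) / rad l)%R)) => //.
  + by rewrite env2.
  + exact: env3.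
  (* The minimum starts with the value of ball 0, which exists because [k] is positive. *)
  + split=> //; exists 0 => //; regs.
    by rewrite (env4 e2) h1 cen2// (envd e2) (envr e2).
  + move=> j s4 lt_j ag4 sj [[l lk h5] h6]; have e4 := env_agree ag4 e3 isT.
    have v4 : ivar s4 18 = i * n by rewrite (agree_ivar ag4)//; regs.
    have cen4 : iarr s4 4 j = cen j by rewrite (agree_iarr ag4)//; regs; exact: cen2.
    apply: runs_step => //; apply: runs_test => //=; regs.
    rewrite sj v4 cen4 (envd e4) (envr e4) -[dm _]/(D i (cen j)).
    case: leP => hle; apply: runs_last => //; regs.
      split; first by exists l.
      by move=> l'; rewrite ltnS leq_eqVlt; case: eqP => [->|_] //=; exact: h6.
    rewrite addr0; split; first by exists j.
    move=> l'; rewrite ltnS leq_eqVlt; case: eqP => [->|_] //= lj.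
    exact: le_trans (ltW hle) (h6 _ lj).
- rewrite /=; lia.
move=> s4 ag4 [[l lk v2] v2min]; have e4 := env_agree ag4 e3 isT.
have v18 : ivar s4 18 = i * n by rewrite (agree_ivar ag4)//; regs.
have v17 : ivar s4 17 = i by rewrite (agree_ivar ag4)//; regs.
have v6 : rvar s4 6 = rvar s2 6 by rewrite (agree_rvar ag4)//; regs.
have vB B : (0 <= B)%R -> cl i -> covers n k D cl rad cen B -> (rvar s4 2 <= B)%R.
  move=> B0 cli /(_ i lt_i cli)[l' l'k h].
  by apply: le_trans (v2min _ l'k) _; rewrite ler_pdivrMr// rad_gt0.
(* Shared by all outcomes of the update: a bound on the old maximum and on the value of [i] covers
   one more client. *)
have cov B : (rvar s2 6 <= B)%R -> (cl i -> (rvar s4 2 <= B)%R) ->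
    covers i.+1 k D cl rad cen B.
  move=> B6 B2 p; rewrite ltnS leq_eqVlt => /predU1P[->|pi] clp.
    by exists l => //; rewrite -ler_pdivrMr ?rad_gt0// -v2; exact: B2.
  have [l' l'k h] := h3 p pi clp; exists l' => //.
  by apply: le_trans h _; rewrite ler_wpM2r// ltW// rad_gt0.
apply: runs_step; first by rewrite /=; lia.
apply: (runs_comp (B1 := 10)); first by rewrite /=; lia.
apply: runs_test => //=; regs; rewrite (env4 e4) (envc e4) v17 -/(cl i).
have [cli|ncli] := boolP (cl i); last first.
  apply: runs_last => //; apply: runs_last; first by rewrite /=; lia.
  regs; rewrite v18 (env0 e4) v6 mulSnr; split=> //.
  by apply: cov => // cli; rewrite cli in ncli.
apply: runs_test => //=; regs; rewrite v6.
case: leP => hle; apply: runs_last => //; (apply: runs_last; first by rewrite /=; lia);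
  regs; rewrite v18 (env0 e4) mulSnr ?v6 ?addr0; split=> //.
- exact: cov.
- exact: le_trans h2 (ltW hle).
- by apply: cov => //; exact: ltW.
- by move=> B B0 covB; exact: vB.
Qed.

Lemma copy_spec s : env s ->
  runs copy_prog s (k * 10 + 10)
    (fun s' => rvar s' 0 = rvar s 6 /\ forall l, l < k -> iarr s' 3 l = iarr s 4 l).
Proof.
move=> e; apply: runs_step; first by rewrite /=; lia.
set s1 := run_block _ _; have e1 : env s1 by exact: env_block.
apply: (runs_leq (B := k * (4 + 2) + 2)); first by rewrite /=; lia.
apply: (runs_for (n := k) (I := fun i s' => rvar s' 0 = rvar s 6 /\
  forall l, l < i -> iarr s' 3 l = iarr s 4 l)) => //.
- by rewrite env2.
- exact: env3.
- by regs; rewrite addr0.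
- move=> i s2 lt_i ag si [h1 h2]; have e2 := env_agree ag e1 isT.
  apply: runs_last => //; regs; rewrite si (agree_iarr ag)//; split=> //.
  by move=> l; rewrite ltnS leq_eqVlt; case: eqP => [->|_] //=; exact: h2.
Qed.

Lemma search_spec s : env s -> f0 < n -> fc f0 -> c0 < n ->
  (forall l, l < k -> (0 < rad l)%R) -> (forall p q, 0 <= D p q)%R ->
  runs search_prog s (k ^ k * (k * (k ^ k * 6 + n * 60 + 90) + n * 10 + 30 +
                        (n * (k * 15 + 40) + 10) + k * 10 + 20 + 2) + 2)
    (fun s' => [/\ (0 <= rvar s' 0)%R, facility_centers n k fc (iarr s' 3),
      covers n k D cl rad (iarr s' 3) (rvar s' 0) &
      forall code B, code < k ^ k -> (0 <= B)%R ->
        covers n k D cl rad (run_code code) B -> (rvar s' 0 <= B)%R]).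
Proof.
move=> e f0n fcf0 c0n rad_gt0 D_ge0.
(* Before the first round there is no result yet, hence the guard [0 < i]; it holds at the end
   because [k ^ k] is positive. *)
apply: (runs_for (n := k ^ k) (I := fun i s' => 0 < i ->
  [/\ (0 <= rvar s' 0)%R, facility_centers n k fc (iarr s' 3),
      covers n k D cl rad (iarr s' 3) (rvar s' 0) &
      forall code B, code < i -> (0 <= B)%R ->
        covers n k D cl rad (run_code code) B -> (rvar s' 0 <= B)%R])) => //.
- by rewrite env9.
- exact: env3.
- move=> i s1 lt_i ag1 si inv; have e1 := env_agree ag1 e isT.
  have code_lt : ivar s1 10 < k ^ k by rewrite si.
  apply: (runs_call (greedy_prog_spec e1 c0n code_lt)); first lia.
  move=> s2 ag2 cen2; have e2 := env_agree ag2 e1 isT.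
  apply: (runs_call (evaluate_spec e2 cen2 rad_gt0 D_ge0)); first lia.
  move=> s3 ag3 [cur0 curcov curmin]; have e3 := env_agree ag3 e2 isT.
  have s3_0 : rvar s3 0 = rvar s1 0 by rewrite (agree_rvar ag3)// (agree_rvar ag2).
  have s3_3 : iarr s3 3 = iarr s1 3 by rewrite (agree_iarr ag3)// (agree_iarr ag2).
  have s3_10 : ivar s3 10 = i by rewrite (agree_ivar ag3)// (agree_ivar ag2).
  have fac : facility_centers n k fc (run_code (ivar s1 10)).
    by apply: greedy_run_facility => // l lk; split.
  (* Copying happens in round 0 and on strict improvement; in both cases the new value beats all
     earlier codes. *)
  have copied : (forall code B, code < i -> (0 <= B)%R ->
      covers n k D cl rad (run_code code) B -> (rvar s3 6 <= B)%R) ->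
      runs copy_prog s3 (k * 10 + 10) (fun s'' => 0 < i.+1 ->
      [/\ (0 <= rvar s'' 0)%R, facility_centers n k fc (iarr s'' 3),
      covers n k D cl rad (iarr s'' 3) (rvar s'' 0) &
      forall code B, code < i.+1 -> (0 <= B)%R ->
        covers n k D cl rad (run_code code) B -> (rvar s'' 0 <= B)%R]).
    move=> small; apply: (runs_weaken (copy_spec e3)) => // s4 [-> cen4] _.
    have cen4' l : l < k -> iarr s4 3 l = run_code (ivar s1 10) l.
      by move=> lk; rewrite cen4// (agree_iarr ag3)// cen2.
    split=> //.
    + by move=> l lk; rewrite cen4'//; exact: fac.
    + by move=> p pn clp; have [l lk h] := curcov p pn clp; exists l; rewrite ?cen4'.
    + move=> code B; rewrite ltnS leq_eqVlt => /predU1P[->|lt_code] B0.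
        by rewrite -si; exact: curmin.
      exact: small.
  apply: runs_test; first lia.
  rewrite /= (env4 e3) s3_10; have [i0|] := ltnP 0 i; last first.
    rewrite leqn0 => /eqP i0; apply: (runs_leq _ (copied _)); first lia.
    by move=> code B; rewrite i0.
  have [b0 bfac bcov bmin] := inv i0.
  apply: runs_test; first lia.
  rewrite /= s3_0; case: leP => hle; last first.
    apply: (runs_leq _ (copied _)); first lia.
    by move=> code B lt_code B0 cov; exact: le_trans (ltW hle) (bmin _ _ lt_code B0 cov).
  apply: runs_last; first by rewrite /=; lia.
  regs => _; rewrite s3_0 s3_3; split=> // code B.
  rewrite ltnS leq_eqVlt => /predU1P[->|lt_code] B0; last exact: bmin.
  by rewrite -si => cov; apply: le_trans hle _; exact: curmin.
- move=> s1 ag; apply; by rewrite expn_gt0 k_gt0.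
Qed.

End Correctness.

(** * Preprocessing: radii of the balls, defaults and the number of codes *)

Section Preprocessing.

Variables (R : realType).

Local Open Scope nat_scope.

Lemma sumn_take_nth (sh : seq nat) i : i < size sh ->
  sumn (take i.+1 sh) = sumn (take i sh) + nth 0 sh i.
Proof. by move=> ish; rewrite (take_nth 0)// sumn_rcons. Qed.

(** The balls of a class occupy consecutive slots, class [i] having [nth 0 sh i] of them, so slot
    [l] belongs to class [reshape_index sh l]. *)
Lemma expand_radii_spec (sh : seq nat) (s : state R) :
  ivar s 1 = size sh -> (forall j, j < size sh -> iarr s 0 j = nth 0 sh j) ->
  runs expand_radii s (size sh * (sumn sh * 5 + 12) + 10)
    (fun s' => [/\ ivar s' 3 = 1, ivar s' 5 = (ivar s 2).-1 &
       forall l, l < sumn sh -> rarr s' 2 l = rarr s 1 (reshape_index sh l)]).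
Proof.
move=> s_1 s0; apply: runs_step; first by rewrite /=; lia.
set s1 := run_block _ _.
have s1_3 : ivar s1 3 = 1 by [].
have s1_5 : ivar s1 5 = (ivar s 2).-1 by regs; rewrite subn1.
pose filled (s' : state R) m :=
  ivar s' 21 = m /\ forall l, l < m -> rarr s' 2 l = rarr s 1 (reshape_index sh l).
apply: (runs_leq (B := size sh * (sumn sh * 5 + 8 + 2) + 2)); first by rewrite /=; lia.
apply: (runs_for (n := size sh) (I := fun i s' => filled s' (sumn (take i sh)))) => //.
- by rewrite /filled take0; regs.
- move=> i s2 lt_i ag2 si [p2 h2].
  have s2_3 : ivar s2 3 = 1 by rewrite (agree_ivar ag2).
  apply: runs_step; first by rewrite /=; lia.
  set s3 := run_block _ _.
  have s3_19 : ivar s3 19 = nth 0 sh i.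
    by regs; rewrite si (agree_iarr ag2)// s0.
  have s3_1 : rvar s3 1 = rarr s 1 i by regs; rewrite si (agree_rarr ag2).
  have le_sum : nth 0 sh i <= sumn sh.
    rewrite -[in sumn sh](cat_take_drop i.+1 sh) sumn_cat sumn_take_nth//; lia.
  apply: (runs_leq (B := nth 0 sh i * (3 + 2) + 2)); first by rewrite /=; lia.
  apply: (runs_for (n := nth 0 sh i) (I := fun h s' =>
    filled s' (sumn (take i sh) + h))) => //.
  + by rewrite addn0; split; regs.
  + move=> h s4 lt_h ag4 sh4 [p4 h4].
    have s4_1 : rvar s4 1 = rarr s 1 i by rewrite (agree_rvar ag4).
    have s4_3 : ivar s4 3 = 1 by rewrite (agree_ivar ag4).
    apply: runs_last => //; split; regs; first by rewrite p4 s4_3 addn1 addnS.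
    move=> l; rewrite addnS ltnS leq_eqVlt p4 s4_1 => /predU1P[->|ll].
      by rewrite eqxx -/(flatten_index sh i h) flatten_indexKl.
    by rewrite ltn_eqF//; exact: h4.
  + by move=> s4 ag4; rewrite /filled sumn_take_nth.
- move=> s2 ag2 [_ h2]; rewrite take_size in h2.
  by rewrite !(agree_ivar ag2).
Qed.

(** The implications cover the case without clients too: variable 8 is then merely some position
    below [n]. *)
Lemma find_defaults_spec (n : nat) (s : state R) :
  ivar s 0 = n -> ivar s 3 = 1 -> ivar s 4 = 0 -> ivar s 6 = 0 -> ivar s 7 = 0 -> ivar s 8 = 0 ->
  0 < n ->
  runs find_defaults s (n * 25 + 10) (fun s' =>
    [/\ ivar s' 6 < n /\ ivar s' 8 < n,
        ivar s' 7 = ivar s' 6 * n,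
        forall p, p < n -> 0 < iarr s 2 p -> 0 < iarr s 2 (ivar s' 6) &
        forall p, p < n -> 0 < iarr s 1 p -> 0 < iarr s 1 (ivar s' 8)]).
Proof.
move=> s_0 s_3 s_4 s_6 s_7 s_8 n0; apply: runs_step; first by rewrite /=; lia.
set s1 := run_block _ _.
apply: (runs_leq (B := n * (20 + 2) + 2)); first by rewrite /=; lia.
apply: (runs_for (n := n) (I := fun i s' =>
    [/\ ivar s' 18 = i * n, ivar s' 6 < n /\ ivar s' 8 < n,
        ivar s' 7 = ivar s' 6 * n,
        forall p, p < i -> 0 < iarr s 2 p -> 0 < iarr s 2 (ivar s' 6) &
        forall p, p < i -> 0 < iarr s 1 p -> 0 < iarr s 1 (ivar s' 8)])) => //.
- by regs; rewrite s_6 s_7 s_8.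
- move=> i s2 lt_i ag si [h1 [h2 h2'] h3 h4 h5].
  have s2_0 : ivar s2 0 = n by rewrite (agree_ivar ag).
  have s2_4 : ivar s2 4 = 0 by rewrite (agree_ivar ag).
  have s2_1 : iarr s2 1 = iarr s 1 by rewrite (agree_iarr ag).
  have s2_2 : iarr s2 2 = iarr s 2 by rewrite (agree_iarr ag).
  apply: runs_step => //; apply: (runs_comp (B1 := 5)) => //.
  apply: runs_test => //=; regs; rewrite s2_4 s2_1 si.
  have [ci|ci] := boolP (0 < iarr s 1 i); apply: runs_last => //; apply: runs_step => //;
    (apply: (runs_comp (B1 := 6)) => //); apply: runs_test => //=; regs;
    rewrite s2_4 s2_2 si;
    have [fi|fi] := boolP (0 < iarr s 2 i); apply: runs_last => //; apply: runs_last => //;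
    regs; rewrite ?s2_4 ?s2_0 ?h1 ?si ?addn0 ?mulSnr; split=> // p;
    rewrite ltnS leq_eqVlt => /predU1P[->|lt_p] //;
    by [exact: h4|exact: h5|rewrite (negPf fi)|rewrite (negPf ci)].
- by move=> s2 ag [].
Qed.

Lemma power_spec (k : nat) (s : state R) : ivar s 2 = k -> ivar s 3 = 1 -> ivar s 4 = 0 ->
  runs power_prog s (k * (k * 5 + 12) + 10)
    (fun s' => ivar s' 9 = k ^ k).
Proof.
move=> s_2 s_3 s_4.
apply: runs_step; first by rewrite /=; lia.
set s1 := run_block _ _.
apply: (runs_leq (B := k * (k * 5 + 8 + 2) + 2)); first by rewrite /=; lia.
apply: (runs_for (n := k) (I := fun i s' => ivar s' 9 = k ^ i)) => //.
move=> i s2 lt_i ag2 si h2.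
have s2_2 : ivar s2 2 = k by rewrite (agree_ivar ag2).
have s2_3 : ivar s2 3 = 1 by rewrite (agree_ivar ag2).
have s2_4 : ivar s2 4 = 0 by rewrite (agree_ivar ag2).
apply: runs_step; first by rewrite /=; lia.
set s3 := run_block _ _.
apply: (runs_call (Q1 := fun s' => ivar s' 13 = k * k ^ i)).
- apply: (runs_for (B := 2) (n := k) (I := fun h s' => ivar s' 13 = h * k ^ i)) => //.
  move=> h s4 lt_h ag4 s4h h4; apply: runs_last => //; regs.
  by rewrite h4 (agree_ivar ag4)//; regs; rewrite h2 mulSnr.
- rewrite /=; lia.
- move=> s4 ag4 h4; apply: runs_last; first by rewrite /=; lia.
  by regs; rewrite h4 (agree_ivar ag4)//; regs; rewrite s2_4 addn0 expnS.
Qed.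

End Preprocessing.

(** [N] stands for [k ^ k]. Every monomial on the left is at most [k ^ 2 * N ^ 2 * n], and 1000
    exceeds the sum of the coefficients. *)
Lemma total_time_le (n k t N : nat) :
  (0 < n)%N -> (0 < k)%N -> (0 < N)%N -> (t <= k)%N ->
  (t * (k * 5 + 12) + 10 + (n * 25 + 10) + (k * (k * 5 + 12) + 10) +
   (N * (k * (N * 6 + n * 60 + 90) + n * 10 + 30 + (n * (k * 15 + 40) + 10) +
         k * 10 + 20 + 2) + 2) <= 1000 * (k ^ 2 * N ^ 2 * n))%N.
Proof.
move=> n0 k0 N0 tk.
have h1 : (t * k <= k * k)%N by rewrite leq_mul2r tk orbT.
have kk : (k <= k * k)%N by rewrite leq_pmulr.
have NN : (N <= N * N)%N by rewrite leq_pmulr.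
set M := (k ^ 2 * N ^ 2 * n)%N.
have ME a b c : (a <= k * k -> b <= N * N -> c <= n -> a * b * c <= M)%N.
  by move=> ha hb hc; rewrite /M -!mulnn; do 2!apply: leq_mul => //.
have m1 : (k * k <= M)%N by have := @ME (k * k)%N 1%N 1%N; rewrite !muln1; apply => //; lia.
have m2 : (n <= M)%N by have := @ME 1%N 1%N n; rewrite !mul1n; apply => //; lia.
have m3 : (N * N * k <= M)%N by have := @ME k (N * N)%N 1%N; rewrite muln1 mulnC; apply.
have m4 : (N * k * n <= M)%N by have := @ME k N n; rewrite [(k * N)%N]mulnC; apply.
have m5 : (N * k <= M)%N by apply: leq_trans m4; rewrite leq_pmulr.
have m6 : (N * n <= M)%N by apply: leq_trans m4; rewrite -mulnA leq_pmul2l// leq_pmull.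
have m7 : (N <= M)%N by apply: leq_trans m6; rewrite leq_pmulr.
have m8 : (1 <= M)%N by lia.
have -> : (N * (k * (N * 6 + n * 60 + 90) + n * 10 + 30 + (n * (k * 15 + 40) + 10) +
         k * 10 + 20 + 2) = (N * N * k) * 6 + (N * k * n) * 75 + (N * k) * 100
         + (N * n) * 50 + N * 62)%N by ring.
lia.
Qed.

(** * The whole program on an abstract distance matrix *)

Section Program.

Variables (R : realType) (n k : nat) (sh : seq nat) (s : state R).

Let D (p q : nat) : R := rarr s 0 (p * n + q)%N.
Let cl : pred nat := fun p => (0 < iarr s 1 p)%N.
Let fc : pred nat := fun p => (0 < iarr s 2 p)%N.
Let rad (l : nat) : R := rarr s 1 (reshape_index sh l).

(** The postcondition quantifies over [delta], so that one run yields both factors: the condition on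
    facilities near a client always holds for [delta = 1], and for [delta = 0] if clients are
    facilities. *)
Lemma nukc_prog_spec :
  ivar s 0 = n -> ivar s 1 = size sh -> ivar s 2 = k ->
  (forall x, (2 < x)%N -> ivar s x = 0%N) ->
  (forall j, (j < size sh)%N -> iarr s 0 j = nth 0%N sh j) ->
  (0 < k)%N -> sumn sh = k -> (size sh <= k)%N ->
  (exists2 p, (p < n)%N & fc p) ->
  (forall j, (j < size sh)%N -> 1 <= rarr s 1 j) ->
  (forall p q, 0 <= D p q) ->
  (forall p q, (p < n)%N -> (q < n)%N -> D p q = D q p) ->
  (forall p q r, (p < n)%N -> (q < n)%N -> (r < n)%N -> D p r <= D p q + D q r) ->
  runs nukc_prog s (1000 * (k ^ 2 * (k ^ k) ^ 2 * n)) (fun s' =>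
    [/\ 0 <= rvar s' 0, facility_centers n k fc (iarr s' 3),
      covers n k D cl rad (iarr s' 3) (rvar s' 0) &
      forall delta alpha o, 0 <= delta -> 0 <= alpha ->
        (forall c q, (c < n)%N -> cl c -> (q < n)%N -> fc q ->
           exists q', [/\ (q' < n)%N, fc q' & D q' c <= delta * D q c]) ->
        facility_centers n k fc o -> covers n k D cl rad o alpha ->
        rvar s' 0 <= (2 + delta) * alpha]).
Proof.
move=> s_0 s_1 s_2 s_x sh0 k0 shk tk [p0 p0n fcp0] rad1 D0 Dsym Dtri.
have n0 : (0 < n)%N by exact: leq_ltn_trans p0n.
have rad_ge1 l : (l < k)%N -> 1 <= rad l.
  by move=> lk; apply/rad1/reshape_indexP; rewrite shk.
apply: (runs_leq (total_time_le n0 k0 (N := k ^ k) _ tk)); first by rewrite expn_gt0 k0.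
apply: (runs_call (expand_radii_spec s_1 sh0)); first by rewrite shk; lia.
move=> s1 ag1 [s1_3 s1_5 s1_r].
have [s1_0 s1_2] : ivar s1 0 = n /\ ivar s1 2 = k by rewrite !(agree_ivar ag1).
have s1_z x : x \in [:: 4; 6; 7; 8]%N -> ivar s1 x = 0%N.
  by rewrite !inE => /or4P[] /eqP->; rewrite (agree_ivar ag1)// s_x.
apply: (runs_call (find_defaults_spec s1_0 s1_3 _ _ _ _ n0)); rewrite ?s1_z//.
  by rewrite shk; lia.
move=> s2 ag2 [[s2_6 s2_8] s2_7 s2_f s2_c].
have [s2_2 s2_3 s2_4] : [/\ ivar s2 2 = k, ivar s2 3 = 1%N & ivar s2 4 = 0%N].
  by rewrite !(agree_ivar ag2)// (s1_z 4%N).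
apply: (runs_call (power_spec s2_2 s2_3 s2_4)); first by rewrite shk; lia.
move=> s3 ag3 s3_9.
pose f0 := ivar s2 6; pose c0 := ivar s2 8.
have e3 : env n k (iarr s 1) (iarr s 2) (rarr s 0) (rarr s3 2) f0 c0 s3.
  split=> //.
  - by rewrite (agree_ivar ag3)// (agree_ivar ag2).
  - by rewrite (agree_ivar ag3).
  - by rewrite (agree_ivar ag3).
  - by rewrite (agree_ivar ag3).
  - by rewrite (agree_ivar ag3)// (agree_ivar ag2)// s1_5 s_2.
  - by rewrite (agree_ivar ag3).
  - by rewrite (agree_ivar ag3).
  - by rewrite (agree_ivar ag3).
  - by rewrite (agree_iarr ag3)// (agree_iarr ag2)// (agree_iarr ag1).
  - by rewrite (agree_iarr ag3)// (agree_iarr ag2)// (agree_iarr ag1).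
  - by rewrite (agree_rarr ag3)// (agree_rarr ag2)// (agree_rarr ag1).
have rad3 l : (l < k)%N -> rarr s3 2 l = rad l.
  by move=> lk; rewrite (agree_rarr ag3)// (agree_rarr ag2)// s1_r// shk.
have rad3_ge1 l : (l < k)%N -> 1 <= rarr s3 2 l.
  by move=> lk; rewrite rad3// rad_ge1.
have s1_2' : iarr s1 2 = iarr s 2 by rewrite (agree_iarr ag1).
have s1_1' : iarr s1 1 = iarr s 1 by rewrite (agree_iarr ag1).
have fcf0 : (0 < iarr s 2 f0)%N by have := s2_f p0 p0n; rewrite s1_2'; exact.
(* The expanded array is known to equal [rad] on its first [k] cells, the only ones that [covers]
   reads. *)
have covE cen B : covers n k D cl rad cen B <-> covers n k D cl (rarr s3 2) cen B.
  by split=> cov p pn clp; have [l lk h] := cov p pn clp; exists l; rewrite // ?rad3// -rad3.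
apply: (runs_weaken (search_spec k0 e3 s2_6 fcf0 s2_8 _ D0)); rewrite ?shk; first 2 last.
- move=> s4 [b0 bfac bcov bmin]; split=> //; first exact/covE.
  move=> delta alpha o delta0 alpha0 near ofac ocov.
  have near' c q : (c < n)%N -> cl c -> (q < n)%N -> fc q ->
      D (nearest n D fc f0 c) c <= delta * D q c.
    move=> cn clc qn fq; have [q' [q'n fq']] := near c q cn clc qn fq.
    by apply: le_trans; exact: nearestP.
  have c0_cl p : (p < n)%N -> cl p -> cl c0 by rewrite /cl -s1_1'; exact: s2_c.
  have [code lt_code cov] := greedy_approx k0 s2_6 fcf0 s2_8 c0_cl rad3_ge1 D0 Dsym
    Dtri delta0 alpha0 near' ofac (proj1 (covE _ _) ocov).
  apply: bmin lt_code _ cov.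
  by rewrite mulr_ge0// addr_ge0.
- by move=> l lk; apply: lt_le_trans (rad3_ge1 l lk).
- lia.
Qed.

End Program.

(** * Positions in lists and prefix sums *)

Section Indexing.

Variable T : Type.

Lemma onth_lt (x0 : T) (s : seq T) p : (p < size s)%N -> onth s p = Some (nth x0 s p).
Proof. by move=> ps; rewrite onthE (nth_map x0). Qed.

Lemma pmap_Some (U : eqType) (f : U -> option T) (g : U -> T) (s : seq U) :
  {in s, forall x, f x = Some (g x)} -> pmap f s = map g s.
Proof.
elim: s => //= x s IH fg; rewrite fg ?mem_head//= IH// => y ys.
by apply: fg; rewrite inE ys orbT.
Qed.

(** Turns the offset in [output_balls] into the prefix sum on which [flatten_index] is based. *)
Lemma sumn_take_enum t (F : 'I_t -> nat) (i : nat) : (i <= t)%N ->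
  sumn (take i [seq F j | j <- enum 'I_t]) = (\sum_(j < t | (j < i)%N) F j)%N.
Proof.
move=> it; pose G m := if insub m is Some j then F j else 0%N.
have FG j : F j = G (val j) by rewrite /G valK.
under eq_bigr do rewrite FG.
rewrite -(big_ord_widen _ G)// (eq_map FG) map_comp val_enum_ord -map_take.
rewrite take_iota (minn_idPl it) sumnE big_map.
by rewrite -[X in iota 0 X]subn0 -/(index_iota 0 i) big_mkord.
Qed.

End Indexing.

(** * Translation between instances and the memory of the program *)

Section Input.

Variables (R : realType) (X : metricType R) (I : nukc X) (pts : seq X) (x0 : X).
Hypothesis x0_facility : x0 \in facilities I.
Hypothesis mem_pts : pts =i (clients I `|` facilities I)%fset.

Let n := size pts.
Let k := num_balls I.
Let t := num_radii I.
Let sh := [seq ball_mult i | i <- enum 'I_t].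
Let s0 := input I pts.
Let pt p := nth x0 pts p.
Let D (p q : nat) : R := rarr s0 0 (p * n + q)%N.
Let cl : pred nat := fun p => (0 < iarr s0 1 p)%N.
Let fc : pred nat := fun p => (0 < iarr s0 2 p)%N.
Let rad (l : nat) : R := rarr s0 1 (reshape_index sh l).

Lemma size_mult : size sh = t.
Proof. by rewrite size_map size_enum_ord. Qed.

Lemma nth_mult (i : 'I_t) : nth 0%N sh i = ball_mult i.
Proof. by rewrite (nth_map i) ?size_enum_ord// nth_ord_enum. Qed.

Lemma sumn_mult : sumn sh = k.
Proof.
have := sumn_take_enum (@ball_mult _ _ I) (leqnn t).
rewrite take_oversize ?size_mult// => ->; rewrite /k -(sum_mult I).
by apply: eq_bigl => j; rewrite ltn_ord.
Qed.

Lemma dist_input p q : (p < n)%N -> (q < n)%N -> D p q = mdist (pt p) (pt q).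
Proof.
move=> pn qn; have n0 : (0 < n)%N by exact: leq_ltn_trans pn.
rewrite /D /= /dist_entry -/n divnMDl// divn_small// addn0 modnMDl modn_small//.
by rewrite !(onth_lt x0).
Qed.

Lemma dist_input_ge0 p q : 0 <= D p q.
Proof.
rewrite /D /= /dist_entry.
by do 2!case: onth => // ?; exact: mdist_ge0.
Qed.

Lemma client_input p : (p < n)%N -> cl p = (pt p \in clients I).
Proof. by move=> pn; rewrite /cl /= /mem_entry (onth_lt x0)//; case: (_ \in _). Qed.

Lemma facility_input p : (p < n)%N -> fc p = (pt p \in facilities I).
Proof. by move=> pn; rewrite /fc /= /mem_entry (onth_lt x0)//; case: (_ \in _). Qed.

Lemma radius_input (i : 'I_t) : rarr s0 1 i = (ball_radius i)%:R.
Proof. by rewrite /= valK. Qed.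

Lemma index_pt x : x \in (clients I `|` facilities I)%fset ->
  (index x pts < n)%N /\ pt (index x pts) = x.
Proof. by rewrite -mem_pts => xp; rewrite index_mem xp /pt nth_index. Qed.

Lemma mem_facility x : x \in facilities I -> x \in (clients I `|` facilities I)%fset.
Proof. by move=> xf; rewrite in_fsetU xf orbT. Qed.

Lemma slot_lt (i : 'I_t) l :
  l \in iota (sumn (take i sh)) (ball_mult i) -> (l < k)%N.
Proof.
rewrite mem_iota => /andP[l1 l2].
rewrite -sumn_mult -(subnKC l1); apply: flatten_indexP.
by rewrite nth_mult ltn_subLR.
Qed.

(** [pmap] drops nothing, since all returned centers are positions of points. *)
Lemma output_balls_map (s : state R) (i : 'I_t) :
  facility_centers n k fc (iarr s 3) ->
  output_balls I pts s i =
    [seq pt (iarr s 3 l) | l <- iota (sumn (take i sh)) (ball_mult i)].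
Proof.
move=> fac; rewrite /output_balls -sumn_take_enum; last exact: ltnW.
apply: pmap_Some => l /slot_lt lk; apply: onth_lt.
by have [] := fac l lk.
Qed.

Lemma feasible_output (s : state R) :
  0 <= rvar s 0 -> facility_centers n k fc (iarr s 3) ->
  covers n k D cl rad (iarr s 3) (rvar s 0) ->
  feasible (output_dilation s) (output_balls I pts s).
Proof.
move=> s_0 fac cov; split=> //.
- by move=> i; rewrite output_balls_map// size_map size_iota.
- move=> i x; rewrite output_balls_map// => /mapP[l /slot_lt lk ->].
  by have [lt_n] := fac l lk; rewrite facility_input.
- move=> c cI; have /index_pt[cn ptc] : c \in (clients I `|` facilities I)%fset by rewrite in_fsetU cI.
  have clc : cl (index c pts) by rewrite client_input// ptc.
  have [l lk h] := cov _ cn clc.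
  have lsh : (l < sumn sh)%N by rewrite sumn_mult.
  have it := reshape_indexP lsh; rewrite size_mult in it.
  have [ln _] := fac l lk.
  (* Slot [l] is ball number [reshape_offset sh l] of its class, so it lies in the range that is
     output for this class. *)
  have := reshape_offsetP lsh; rewrite -/(nat_of_ord (Ordinal it)) nth_mult => hm.
  exists (Ordinal it), (pt (iarr s 3 l)).
    rewrite output_balls_map//; apply/mapP; exists l => //.
    by rewrite mem_iota -{2 3}(reshape_indexK sh l) leq_addr ltn_add2l.
  by move: h; rewrite dist_input// ptc metric_sym /rad (radius_input (Ordinal it)).
Qed.

(** The lists of [S] are flattened class by class, and each center is replaced by its position in
    [pts]. *)
Lemma feasible_covers (alpha : R) (S : choice_of_balls I) : feasible alpha S ->
  exists2 o, facility_centers n k fc o & covers n k D cl rad o alpha.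
Proof.
move=> [_ sizeS facS covS].
pose ss := [seq S i | i <- enum 'I_t]; pose fs := flatten ss.
have shape_ss : shape ss = sh.
  by rewrite /shape -map_comp; apply: eq_map => i /=; exact: sizeS.
have size_fs : size fs = k by rewrite size_flatten shape_ss sumn_mult.
have fs_fac l : (l < k)%N -> nth x0 fs l \in facilities I.
  move=> lk; have : nth x0 fs l \in fs by rewrite mem_nth// size_fs.
  by move=> /flattenP[_ /mapP[i _ ->]]; exact: facS.
exists (fun l => index (nth x0 fs l) pts).
  move=> l lk; have [ln ptl] := index_pt (mem_facility (fs_fac l lk)).
  by split=> //; rewrite facility_input// ptl; exact: fs_fac.
move=> p pn; rewrite client_input// => /covS[i [x xS h]].
have hi : (index x (S i) < nth 0 sh i)%N by rewrite nth_mult -sizeS index_mem.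
have lk := flatten_indexP hi; rewrite sumn_mult in lk.
have fsx : nth x0 fs (flatten_index sh i (index x (S i))) = x.
  rewrite nth_flatten shape_ss flatten_indexKl// flatten_indexKr//.
  by rewrite (nth_map i) ?size_enum_ord// nth_ord_enum nth_index.
exists (flatten_index sh i (index x (S i))) => //.
have [ln ptl] := index_pt (mem_facility (facS _ _ xS)).
by rewrite fsx dist_input// ptl metric_sym /rad flatten_indexKl// radius_input.
Qed.

(** Comparison with each feasible dilation suffices: [b / gamma] is then a lower bound of a nonempty
    set, hence at most its infimum. *)
Lemma le_opt_dilation (b gamma : R) : 0 < gamma ->
  (exists alpha (S : choice_of_balls I), feasible alpha S) ->
  (forall alpha (S : choice_of_balls I), feasible alpha S -> b <= gamma * alpha) ->
  b <= gamma * opt_dilation I.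
Proof.
move=> g0 [a0 [S0 feas0]] h; rewrite mulrC -ler_pdivrMr//.
apply: lb_le_inf; first by exists a0, S0.
by move=> a [S feas]; rewrite ler_pdivrMr// mulrC; exact: h feas.
Qed.

Lemma nukc_prog_input :
  runs nukc_prog s0 (1000 * (k ^ 2 * (k ^ k) ^ 2 * n)) (fun s =>
    approx_solution 3 (output_dilation s) (output_balls I pts s) /\
    (clients I = facilities I ->
       approx_solution 2 (output_dilation s) (output_balls I pts s))).
Proof.
have [x0n ptx0] := index_pt (mem_facility x0_facility).
apply: (runs_weaken (@nukc_prog_spec R n k sh s0 _ _ _ _ _ _ _ _ _ _ _ _ _)) => //.
- by rewrite size_mult.
- by case=> [|[|[|x]]] //= _; rewrite nth_default.
- move=> j; rewrite size_mult => jt /=.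
  by rewrite insubT -[j in RHS]/(nat_of_ord (Ordinal jt)) nth_mult.
- exact: num_balls_gt0.
- exact: sumn_mult.
- by rewrite size_mult; exact: num_radii_le.
- by exists (index x0 pts) => //; rewrite -/(fc _) facility_input// ptx0.
- move=> j; rewrite size_mult => jt; rewrite -/(nat_of_ord (Ordinal jt)) radius_input.
  by rewrite ler1n radius_gt0.
- exact: dist_input_ge0.
- by move=> p q pn qn; rewrite -!/(D _ _) !dist_input// metric_sym.
- by move=> p q r pn qn rn; rewrite -!/(D _ _) !dist_input//; exact: metric_triangle.
move=> s [s_0 fac cov best].
have feas := feasible_output s_0 fac cov.
have approx delta : 0 <= delta ->
    (forall c q, (c < n)%N -> cl c -> (q < n)%N -> fc q ->
       exists q', [/\ (q' < n)%N, fc q' & D q' c <= delta * D q c]) ->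
    approx_solution (2 + delta) (output_dilation s) (output_balls I pts s).
  move=> d0 near; split=> //; apply: le_opt_dilation.
  - exact: ltr_wpDr.
  - by exists (output_dilation s), (output_balls I pts s).
  - move=> alpha S feasS; have [alpha0 _ _ _] := feasS.
    have [opt ofac ocov] := feasible_covers feasS.
    exact: best ofac ocov.
split.
  rewrite (_ : 3 = 2 + 1); last by ring.
  (* For [delta = 1] the facility [q] itself qualifies. *)
  by apply: approx => // c q _ _ qn fq; exists q; rewrite mul1r.
(* For [delta = 0] the client [c] is a facility at distance 0 from itself. *)
move=> CF; rewrite -[2]addr0; apply: approx => // c q cn clc _ _; exists c.
split=> //; first by rewrite facility_input// -CF -client_input.
by rewrite mul0r dist_input// mdistxx.
Qed.

End Input.

(** * The running time as a power of two *)

Section TimeExponent.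

Variables (R : realType) (C : nat).
Hypothesis C_gt0 : (0 < C)%N.

(** For positive [k], the binary logarithm of [C * k ^ (2 * k + 2)], where [k ^ (2 * k + 2)] is
    [k ^ 2 * (k ^ k) ^ 2]. *)
Definition time_exponent (k : nat) : R :=
  (ln C%:R + (2 * k + 2)%:R * ln k%:R) / ln 2.

Lemma powR_time_exponent k : (0 < k)%N ->
  2 `^ time_exponent k = (C * (k ^ 2 * (k ^ k) ^ 2))%:R.
Proof.
move=> k0; rewrite /powR ifF; last by apply/negbTE.
rewrite divfK; last by rewrite gt_eqF// ln_gt0// ltr1n.
rewrite expRD lnK ?posrE ?ltr0n// expRM_natl lnK ?posrE ?ltr0n//.
rewrite natrM -expnM -expnD natrX; congr (_ * _ ^+ _); lia.
Qed.

Lemma time_exponent_bigO :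
  time_exponent =O_\oo (fun k : nat => k%:R * ln (k%:R : R)).
Proof.
have ln2 : 0 < ln 2 :> R by rewrite ln_gt0// ltr1n.
have lnC : 0 <= ln C%:R :> R by rewrite ln_ge0// ler1n.
(* For [k] at least 2, [ln k] is at least [ln 2], so [ln C] is at most [ln C / ln 2] times
   [k * ln k]; moreover [2 * k + 2] is at most [4 * k]. *)
apply/eqO_exP; exists ((ln C%:R / ln 2 + 4) / ln 2).
  by rewrite divr_gt0// ltr_wpDl// divr_ge0// ltW.
near=> k.
have k2 : (2 <= k)%N by near: k; exact: nbhs_infty_ge.
have lnk : ln 2 <= ln k%:R :> R by rewrite ler_ln ?posrE ?ler_nat ?ltr0n//; lia.
have k1 : 1 <= k%:R :> R by rewrite ler1n; lia.
have lnk0 : 0 <= ln k%:R :> R by apply: le_trans lnk; exact: ltW.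
rewrite !ger0_norm; last 2 first.
- by rewrite mulr_ge0.
- by rewrite divr_ge0 ?(ltW ln2)// addr_ge0 ?lnC// mulr_ge0.
rewrite /time_exponent mulrAC ler_pM2r ?invr_gt0// mulrDl; apply: lerD.
  rewrite -mulrA ler_peMr ?lnC// mulrC ler_pdivlMr// mul1r.
  by apply: le_trans lnk _; rewrite ler_peMl.
rewrite mulrA ler_wpM2r//.
by rewrite -natrM ler_nat; lia.
Unshelve. all: by end_near.
Qed.

End TimeExponent.

Theorem theorem11 :
  exists P : program, forall R : realType,
  exists2 f : nat -> R, f =O_\oo (fun k : nat => k%:R * ln (k%:R : R)) &
  forall (X : metricType R) (I : nukc X) (pts : seq X),
    facilities I != fset0 ->
    uniq pts -> pts =i (clients I `|` facilities I)%fset ->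
    exists (T : nat) (s : state R),
      [/\ exec P (input I pts) T s,
          T%:R <= 2 `^ f (num_balls I)
                  * (#|` (clients I `|` facilities I)%fset |%:R : R) ^+ 2,
          approx_solution 3 (output_dilation s) (output_balls I pts s) &
          clients I = facilities I ->
            approx_solution 2 (output_dilation s) (output_balls I pts s)].
Proof.
exists nukc_prog => R; exists (time_exponent R 1000); first exact: time_exponent_bigO.
move=> X I pts /fset0Pn[x0 x0F] uniq_pts mem_pts.
have [T [s [ex TB [approx3 approx2]]]] := nukc_prog_input x0F mem_pts.
exists T, s; split=> //; rewrite powR_time_exponent ?num_balls_gt0//.
have -> : #|` (clients I `|` facilities I)%fset | = size pts.
  by apply/esym/perm_size/uniq_perm => //; exact: fset_uniq.
rewrite -natrX -natrM ler_nat; apply: leq_trans TB _.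
rewrite mulnA; apply: leq_mul => //.
(* The time bound obtained is linear in [size pts], which is at most its square. *)
by case: (size pts) => // m; rewrite -mulnn leq_pmulr.
Qed.
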